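(* Let $\mathcal{P}$ and $\mathcal{Q}$ be binary quadratic regular operads generated by finite dimensional modules. Then the black square product satisfies $$(\mathcal{P}\,\blacksquare\,\mathcal{Q})^!=\mathcal{P}^!\,\square\,\mathcal{Q}^!.$$
   Context: The ground field $k$ has characteristic $0$. A non-symmetric operad $\{\mathcal{P}'_n\}_{n\ge1}$ is an operad without symmetric group actions; $\Sigma$ associates to it the (symmetric) operad $\mathcal{P}(n)=\mathcal{P}'_n\otimes k[\mathbb{S}_n]$. Operads in the image of $\Sigma$ are called regular; $U$ denotes the inverse equivalence from regular to non-symmetric operads. A binary quadratic regular operad is $\mathcal{P}=\Sigma(\mathcal{P}')$ with $\mathcal{P}'=\mathcal{F}(V')/(R')$, $V'$ a vector space in arity $2$, $\mathcal{F}(V')$ the free non-symmetric operad and $R'\subset\mathcal{F}(V')(3)$, where $\mathcal{F}(V')(3)=(V'\otimes V')\oplus(V'\otimes V')$ is spanned by $\mu\circ_1\nu=\mu(\nu(x,y),z)$ and $\mu\circ_2\nu=\mu(x,\nu(y,z))$. Koszul dual: $\mathcal{P}^!=\Sigma(\mathcal{F}(V'^* )/(R'^\perp))$, the orthogonal being for the pairing $\mathcal{F}(V')(3)\otimes\mathcal{F}(V'^* )(3)\to k$ with $\langle\mu\circ_1\nu,\zeta\circ_1\xi\rangle=\zeta(\mu)\xi(\nu)$, $\langle\mu\circ_2\nu,\zeta\circ_2\xi\rangle=-\zeta(\mu)\xi(\nu)$, other products zero. For $\mathcal{P}'=\mathcal{F}(V')/(R')$ and $\mathcal{Q}'=\mathcal{F}(W')/(S')$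 let $\Phi:\mathcal{F}(V'\otimes W')(3)\to\mathcal{F}(V')(3)\otimes\mathcal{F}(W')(3)$, $\Phi((\mu\otimes\mu')\circ_i(\nu\otimes\nu'))=(\mu\circ_i\nu)\otimes(\mu'\circ_i\nu')$, and let $\Psi:\mathcal{F}(V')(3)\otimes\mathcal{F}(W')(3)\to\mathcal{F}(V'\otimes W')(3)$ be the transpose of $\Phi_{V'^*,W'^*}$ with respect to the pairings, explicitly $\Psi((\mu\circ_i\nu)\otimes(\mu'\circ_j\nu'))=\delta_{ij}(-1)^{i-1}(\mu\otimes\mu')\circ_i(\nu\otimes\nu')$. The white and black square products of $\mathcal{P}=\Sigma(\mathcal{P}')$ and $\mathcal{Q}=\Sigma(\mathcal{Q}')$ are $$\mathcal{P}\,\square\,\mathcal{Q}=\Sigma\Big(\mathcal{F}(V'\otimes W')/\big(\Phi^{-1}(R'\otimes\mathcal{F}(W')(3)+\mathcal{F}(V')(3)\otimes S')\big)\Big),\qquad \mathcal{P}\,\blacksquare\,\mathcal{Q}=\Sigma\big(\mathcal{F}(V'\otimes W')/(\Psi(R'\otimes S'))\big).$$ *)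

(* Defs.v *)
From HB Require Import structures.
From mathcomp Require Import all_boot all_order all_fingroup all_algebra.
From mathcomp Require Import generic_quotient boolp zify.
Set Implicit Arguments.
Unset Strict Implicit.
Unset Printing Implicit Defensive.
Import GRing.Theory.
Local Open Scope quotient_scope.
Local Open Scope ring_scope.

Section Quotient.
Variable k : fieldType.

(* A vector space structure up to the equivalence prel. *)
Record preModule := PreModule {
  pcar : Type;
  prel : pcar -> pcar -> Prop;
  pzero : pcar;
  padd : pcar -> pcar -> pcar;
  pscale : k -> pcar -> pcar;
  prel_refl : forall x, prel x x;
  prel_sym : forall x y, prel x y -> prel y x;
  prel_trans : forall x y z, prel x y -> prel y z -> prel x z;
  prel_add : forall x x' y y', prel x x' -> prel y y' -> prel (padd x y) (padd x' y');
  prel_scale : forall a x x', prel x x' -> prel (pscale a x) (pscale a x');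
  prel_addA : forall x y z, prel (padd x (padd y z)) (padd (padd x y) z);
  prel_addC : forall x y, prel (padd x y) (padd y x);
  prel_add0 : forall x, prel (padd pzero x) x;
  prel_addN : forall x, prel (padd (pscale (-1) x) x) pzero;
  prel_scaleA : forall a b x, prel (pscale a (pscale b x)) (pscale (a * b) x);
  prel_scale1 : forall x, prel (pscale 1 x) x;
  prel_scaleDr : forall a x y, prel (pscale a (padd x y)) (padd (pscale a x) (pscale a y));
  prel_scaleDl : forall a b x, prel (pscale (a + b) x) (padd (pscale a x) (pscale b x))
}.

Variable S : preModule.

Definition prelb : rel {classic pcar S} := fun x y => `[< prel x y >].
Fact prelb_refl : reflexive prelb.
Proof. by move=> x; apply/asboolP; apply: prel_refl. Qed.
Fact prelb_sym : symmetric prelb.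
Proof. by move=> x y; apply: asbool_equiv_eq; split; apply: prel_sym. Qed.
Fact prelb_trans : transitive prelb.
Proof. by move=> y x z /asboolP xy /asboolP yz; apply/asboolP/(prel_trans xy yz). Qed.
Canonical prelb_equiv := EquivRel prelb prelb_refl prelb_sym prelb_trans.

Definition quotModule := {eq_quot prelb}.
HB.instance Definition _ := Choice.on quotModule.

Definition qcl (x : pcar S) : quotModule := \pi_quotModule x.
Definition qrep (x : quotModule) : pcar S := repr x.

Lemma qrepK x : qcl (qrep x) = x. Proof. exact: reprK. Qed.
Lemma qclP x y : qcl x = qcl y <-> prel x y.
Proof.
rewrite /qcl; split=> [/eqmodP/asboolP //|xy].
by apply/eqmodP/asboolP.
Qed.
Lemma qrepP x : prel (qrep (qcl x)) x.
Proof. by apply/qclP; rewrite qrepK. Qed.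

Let add x y := qcl (padd (qrep x) (qrep y)).
Let scale a x := qcl (pscale a (qrep x)).
Let addE x y : add (qcl x) (qcl y) = qcl (padd x y).
Proof. by apply/qclP/prel_add; apply: qrepP. Qed.
Let scaleE a x : scale a (qcl x) = qcl (pscale a x).
Proof. by apply/qclP/prel_scale; apply: qrepP. Qed.

Let addA : associative add.
Proof.
move=> x y z; rewrite -[x]qrepK -[y]qrepK -[z]qrepK !addE.
by apply/qclP/prel_addA.
Qed.
Let addC : commutative add.
Proof. by move=> x y; apply/qclP/prel_addC. Qed.
Let add0 : left_id (qcl (pzero S)) add.
Proof. by move=> x; rewrite -[x]qrepK addE; apply/qclP/prel_add0. Qed.
Let addN : left_inverse (qcl (pzero S)) (scale (-1)) add.
Proof. by move=> x; rewrite -[x]qrepK scaleE addE; apply/qclP/prel_addN. Qed.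
HB.instance Definition _ := GRing.isZmodule.Build quotModule addA addC add0 addN.

Let scaleA a b x : scale a (scale b x) = scale (a * b) x.
Proof. by rewrite -[x]qrepK !scaleE; apply/qclP/prel_scaleA. Qed.
Let scale1 : left_id 1 scale.
Proof. by move=> x; rewrite -[x]qrepK !scaleE; apply/qclP/prel_scale1. Qed.
Let scaleDr : right_distributive scale +%R.
Proof.
move=> a x y; rewrite -[x]qrepK -[y]qrepK; rewrite [_ + _]addE !scaleE [_ + _]addE.
exact/qclP/prel_scaleDr.
Qed.
Let scaleDl x : {morph scale^~ x : a b / a + b}.
Proof.
move=> a b; rewrite -[x]qrepK !scaleE [RHS]addE.
exact/qclP/prel_scaleDl.
Qed.
HB.instance Definition _ :=
  GRing.Zmodule_isLmodule.Build k quotModule scaleA scale1 scaleDr scaleDl.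

Lemma qcl0 : qcl (pzero S) = 0. Proof. by []. Qed.
Lemma qclD x y : qcl (padd x y) = qcl x + qcl y. Proof. by rewrite -addE. Qed.
Lemma qclZ a x : qcl (pscale a x) = a *: qcl x. Proof. by rewrite -scaleE. Qed.
End Quotient.

(* Component n of an operad is the space of operations of arity n.+1, so that
   arities start at 1 and partial composition is additive in the index; inputs
   are numbered from 0.  The target index p comes with a proof of p = m + n, so
   that the axioms involve no transport. *)
Record nsOperad (k : fieldType) := NsOperad {
  ns_sp :> nat -> lmodType k;
  ns_id : ns_sp 0;
  ns_comp : forall m n p, p = (m + n)%N -> 'I_m.+1 ->
    ns_sp m -> ns_sp n -> ns_sp p;
  ns_compDl : forall m n p (e : p = (m + n)%N) i c a a' b,
    ns_comp e i (c *: a + a') b = c *: ns_comp e i a b + ns_comp e i a' b;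
  ns_compDr : forall m n p (e : p = (m + n)%N) i c a b b',
    ns_comp e i a (c *: b + b') = c *: ns_comp e i a b + ns_comp e i a b';
  ns_comp1l : forall n (e : n = (0 + n)%N) a, ns_comp e ord0 ns_id a = a;
  ns_comp1r : forall n (e : n = (n + 0)%N) i a, ns_comp e i a ns_id = a;
  ns_compA : forall m n q mn nq p (e1 : mn = (m + n)%N) (e2 : p = (mn + q)%N)
      (e3 : nq = (n + q)%N) (e4 : p = (m + nq)%N)
      (i : 'I_m.+1) (j : 'I_n.+1) (h : 'I_mn.+1) a b c,
    h = (i + j)%N :> nat ->
    ns_comp e2 h (ns_comp e1 i a b) c = ns_comp e4 i a (ns_comp e3 j b c);
  ns_compC : forall m n q mn mq p (e1 : mn = (m + n)%N) (e2 : p = (mn + q)%N)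
      (e3 : mq = (m + q)%N) (e4 : p = (mq + n)%N)
      (i j : 'I_m.+1) (h : 'I_mn.+1) (i' : 'I_mq.+1) a b c,
    (i < j)%N -> h = (j + n)%N :> nat -> i' = i :> nat ->
    ns_comp e2 h (ns_comp e1 i a b) c = ns_comp e4 i' (ns_comp e3 j a c) b
}.
Arguments ns_id {k} _.
Arguments ns_comp {k} _ {m n p} _ _ _ _.

Section NsOperadTheory.
Variables (k : fieldType) (P : nsOperad k).
Implicit Types m n p : nat.

Lemma ns_comp0l m n p (e : p = (m + n)%N) i b : ns_comp P e i 0 b = 0.
Proof. by have := ns_compDl e i (-1) 0 0 b; rewrite !scaleN1r oppr0 addr0 addNr. Qed.
Lemma ns_comp0r m n p (e : p = (m + n)%N) i a : ns_comp P e i a 0 = 0.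
Proof. by have := ns_compDr e i (-1) a 0 0; rewrite !scaleN1r oppr0 addr0 addNr. Qed.
Lemma ns_compBl m n p (e : p = (m + n)%N) i a a' b :
  ns_comp P e i (a - a') b = ns_comp P e i a b - ns_comp P e i a' b.
Proof. by rewrite addrC -!scaleN1r ns_compDl addrC. Qed.
Lemma ns_compBr m n p (e : p = (m + n)%N) i a b b' :
  ns_comp P e i a (b - b') = ns_comp P e i a b - ns_comp P e i a b'.
Proof. by rewrite addrC -!scaleN1r ns_compDr addrC. Qed.
Lemma ns_comp_suml m n p (e : p = (m + n)%N) i I r (C : pred I) (F : I -> P m) b :
  ns_comp P e i (\sum_(x <- r | C x) F x) b = \sum_(x <- r | C x) ns_comp P e i (F x) b.
Proof.
apply: (big_morph (fun a => ns_comp P e i a b)); last exact: ns_comp0l.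
by move=> a a'; rewrite -[a in LHS]scale1r ns_compDl scale1r.
Qed.
Lemma ns_comp_sumr m n p (e : p = (m + n)%N) i I r (C : pred I) a (F : I -> P n) :
  ns_comp P e i a (\sum_(x <- r | C x) F x) = \sum_(x <- r | C x) ns_comp P e i a (F x).
Proof.
apply: (big_morph (fun b => ns_comp P e i a b)); last exact: ns_comp0r.
by move=> b b'; rewrite -[b in LHS]scale1r ns_compDr scale1r.
Qed.
End NsOperadTheory.

#[local] Obligation Tactic := idtac.

Section OperadicIdeals.
Variables (k : fieldType) (P : nsOperad k).

Record isIdeal (I : forall n, P n -> Prop) : Prop := IsIdeal {
  ideal0 : forall n, I n 0;
  ideal_lin : forall n c a b, I n a -> I n b -> I n (c *: a + b);
  ideal_compl : forall m n p (e : p = (m + n)%N) i a b,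
    I m a -> I p (ns_comp P e i a b);
  ideal_compr : forall m n p (e : p = (m + n)%N) i a b,
    I n b -> I p (ns_comp P e i a b)
}.

(* The intersection of the ideals containing X. *)
Definition genIdeal (X : forall n, P n -> Prop) n (a : P n) : Prop :=
  forall I : forall n, P n -> Prop,
    isIdeal I -> (forall n b, X n b -> I n b) -> I n a.

Lemma genIdealP X : isIdeal (genIdeal X).
Proof.
split=> [n|n c a b Ia Ib|m n p e i a b Ia|m n p e i a b Ib] I idI sXI.
- exact: ideal0.
- by apply: ideal_lin => //; [apply: Ia | apply: Ib].
- by apply: ideal_compl => //; apply: Ia.
- by apply: ideal_compr => //; apply: Ib.
Qed.
Lemma sub_genIdeal X n (a : P n) : X n a -> genIdeal X a.
Proof. by move=> Xa I _; apply. Qed.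

Variables (I : forall n, P n -> Prop) (idI : isIdeal I).

Lemma idealD n (a b : P n) : I a -> I b -> I (a + b).
Proof. by move=> Ia Ib; rewrite -[a]scale1r; apply: (ideal_lin idI). Qed.
Lemma idealZ n c (a : P n) : I a -> I (c *: a).
Proof. by move=> Ia; rewrite -[_ *: _]addr0; apply: (ideal_lin idI) => //; exact: (ideal0 idI). Qed.
Lemma idealB n (a b : P n) : I a -> I b -> I (a - b).
Proof. by move=> Ia Ib; rewrite -scaleN1r addrC; apply: (ideal_lin idI). Qed.

Section Fibre.
Variable n : nat.
Definition congI (a b : P n) := I (a - b).
Program Definition quotPre : preModule k := @PreModule k (P n) congI 0 +%R *:%R
  _ _ _ _ _ _ _ _ _ _ _ _ _.
Next Obligation. by move=> x; rewrite /congI subrr; exact: (ideal0 idI). Qed.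
Next Obligation. by move=> x y Ixy; rewrite /congI -opprB -scaleN1r; apply: idealZ. Qed.
Next Obligation. by move=> x y z Ixy Iyz; rewrite /congI -(subrKA y); apply: idealD. Qed.
Next Obligation. by move=> x x' y y' Ix Iy; rewrite /congI opprD addrACA; apply: idealD. Qed.
Next Obligation. by move=> a x x' Ix; rewrite /congI -scalerBr; apply: idealZ. Qed.
Next Obligation. by move=> x y z; rewrite /congI addrA subrr; exact: (ideal0 idI). Qed.
Next Obligation. by move=> x y; rewrite /congI [x + y]addrC subrr; exact: (ideal0 idI). Qed.
Next Obligation. by move=> x; rewrite /congI add0r subrr; exact: (ideal0 idI). Qed.
Next Obligation. by move=> x; rewrite /congI scaleN1r addNr subrr; exact: (ideal0 idI). Qed.
Next Obligation. by move=> a b x; rewrite /congI scalerA subrr; exact: (ideal0 idI). Qed.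
Next Obligation. by move=> x; rewrite /congI scale1r subrr; exact: (ideal0 idI). Qed.
Next Obligation. by move=> a x y; rewrite /congI scalerDr subrr; exact: (ideal0 idI). Qed.
Next Obligation. by move=> a b x; rewrite /congI scalerDl subrr; exact: (ideal0 idI). Qed.
End Fibre.

Definition quotSp n : lmodType k := quotModule (quotPre n).
Definition quotPi n (a : P n) : quotSp n := qcl (a : pcar (quotPre n)).
Lemma quotPiP n (a b : P n) : quotPi a = quotPi b <-> I (a - b).
Proof. exact: qclP. Qed.
Lemma quotPi_lin n c (a b : P n) : quotPi (c *: a + b) = c *: quotPi a + quotPi b.
Proof. by rewrite /quotPi (@qclD _ (quotPre n)) (@qclZ _ (quotPre n)). Qed.
Lemma quotPi_surj n (x : quotSp n) : exists a, x = quotPi a.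
Proof. by exists (qrep x); rewrite /quotPi qrepK. Qed.

Definition quotComp m n p (e : p = (m + n)%N) (i : 'I_m.+1)
    (x : quotSp m) (y : quotSp n) : quotSp p :=
  quotPi (ns_comp P e i (qrep x) (qrep y)).

Lemma quotCompE m n p (e : p = (m + n)%N) i (a : P m) (b : P n) :
  quotComp e i (quotPi a) (quotPi b) = quotPi (ns_comp P e i a b).
Proof.
apply/quotPiP; set a' := qrep _; set b' := qrep _.
rewrite -(subrKA (ns_comp P e i a b')) -ns_compBl -ns_compBr.
apply: idealD; first by apply: (ideal_compl idI); apply: (@qrepP _ (quotPre m)).
by apply: (ideal_compr idI); apply: (@qrepP _ (quotPre n)).
Qed.

Program Definition quotOperad : nsOperad k :=
  @NsOperad k quotSp (quotPi (ns_id P)) quotComp _ _ _ _ _ _.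
Next Obligation.
move=> m n p e i c x x' y.
have [[a ->] [a' ->] [b ->]] := And3 (quotPi_surj x) (quotPi_surj x') (quotPi_surj y).
by rewrite -quotPi_lin !quotCompE ns_compDl quotPi_lin.
Qed.
Next Obligation.
move=> m n p e i c x y y'.
have [[a ->] [b ->] [b' ->]] := And3 (quotPi_surj x) (quotPi_surj y) (quotPi_surj y').
by rewrite -quotPi_lin !quotCompE ns_compDr quotPi_lin.
Qed.
Next Obligation.
by move=> n e x; have [a ->] := quotPi_surj x; rewrite quotCompE ns_comp1l.
Qed.
Next Obligation.
by move=> n e i x; have [a ->] := quotPi_surj x; rewrite quotCompE ns_comp1r.
Qed.
Next Obligation.
move=> m n q mn nq p e1 e2 e3 e4 i j h x y z hE.
have [[a ->] [b ->] [c ->]] := And3 (quotPi_surj x) (quotPi_surj y) (quotPi_surj z).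
by rewrite !quotCompE (ns_compA e1 e2 e3 e4 _ _ _ hE).
Qed.
Next Obligation.
move=> m n q mn mq p e1 e2 e3 e4 i j h i' x y z ij hE iE.
have [[a ->] [b ->] [c ->]] := And3 (quotPi_surj x) (quotPi_surj y) (quotPi_surj z).
by rewrite !quotCompE (ns_compC e1 e2 e3 e4 _ _ _ ij hE iE).
Qed.
End OperadicIdeals.

(* The free operad on V placed in arity 2: terms modulo linearity of the
   generators and the axioms of operads. *)
Section FreeOperad.
Variables (k : fieldType) (V : lmodType k).

Inductive term : nat -> Type :=
| TId : term 0
| TGen : V -> term 1
| TComp m n p : p = (m + n)%N -> 'I_m.+1 -> term m -> term n -> term p
| TZero n : term n
| TAdd n : term n -> term n -> term n
| TScale n : k -> term n -> term n.

Inductive teq : forall n, term n -> term n -> Prop :=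
| teq_refl n (x : term n) : teq x x
| teq_sym n (x y : term n) : teq x y -> teq y x
| teq_trans n (x y z : term n) : teq x y -> teq y z -> teq x z
| teq_add n (x x' y y' : term n) : teq x x' -> teq y y' -> teq (TAdd x y) (TAdd x' y')
| teq_scale n c (x x' : term n) : teq x x' -> teq (TScale c x) (TScale c x')
| teq_comp m n p (e : p = (m + n)%N) i (x x' : term m) (y y' : term n) :
    teq x x' -> teq y y' -> teq (TComp e i x y) (TComp e i x' y')
| teq_addA n (x y z : term n) : teq (TAdd x (TAdd y z)) (TAdd (TAdd x y) z)
| teq_addC n (x y : term n) : teq (TAdd x y) (TAdd y x)
| teq_add0 n (x : term n) : teq (TAdd (TZero n) x) x
| teq_addN n (x : term n) : teq (TAdd (TScale (-1) x) x) (TZero n)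
| teq_scaleA n c d (x : term n) : teq (TScale c (TScale d x)) (TScale (c * d) x)
| teq_scale1 n (x : term n) : teq (TScale 1 x) x
| teq_scaleDr n c (x y : term n) :
    teq (TScale c (TAdd x y)) (TAdd (TScale c x) (TScale c y))
| teq_scaleDl n c d (x : term n) :
    teq (TScale (c + d) x) (TAdd (TScale c x) (TScale d x))
| teq_gen c (u v : V) : teq (TGen (c *: u + v)) (TAdd (TScale c (TGen u)) (TGen v))
| teq_compDl m n p (e : p = (m + n)%N) i c (x x' : term m) (y : term n) :
    teq (TComp e i (TAdd (TScale c x) x') y)
        (TAdd (TScale c (TComp e i x y)) (TComp e i x' y))
| teq_compDr m n p (e : p = (m + n)%N) i c (x : term m) (y y' : term n) :
    teq (TComp e i x (TAdd (TScale c y) y'))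
        (TAdd (TScale c (TComp e i x y)) (TComp e i x y'))
| teq_comp1l n (e : n = (0 + n)%N) (x : term n) : teq (TComp e ord0 TId x) x
| teq_comp1r n (e : n = (n + 0)%N) i (x : term n) : teq (TComp e i x TId) x
| teq_compA m n q mn nq p (e1 : mn = (m + n)%N) (e2 : p = (mn + q)%N)
      (e3 : nq = (n + q)%N) (e4 : p = (m + nq)%N)
      (i : 'I_m.+1) (j : 'I_n.+1) (h : 'I_mn.+1)
      (x : term m) (y : term n) (z : term q) :
    h = (i + j)%N :> nat ->
    teq (TComp e2 h (TComp e1 i x y) z) (TComp e4 i x (TComp e3 j y z))
| teq_compC m n q mn mq p (e1 : mn = (m + n)%N) (e2 : p = (mn + q)%N)
      (e3 : mq = (m + q)%N) (e4 : p = (mq + n)%N)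
      (i j : 'I_m.+1) (h : 'I_mn.+1) (i' : 'I_mq.+1)
      (x : term m) (y : term n) (z : term q) :
    (i < j)%N -> h = (j + n)%N :> nat -> i' = i :> nat ->
    teq (TComp e2 h (TComp e1 i x y) z) (TComp e4 i' (TComp e3 j x z) y).

Definition freePre n : preModule k :=
  @PreModule k (term n) (@teq n) (TZero n) (@TAdd n) (@TScale n)
    (@teq_refl n) (@teq_sym n) (@teq_trans n) (@teq_add n) (@teq_scale n)
    (@teq_addA n) (@teq_addC n) (@teq_add0 n) (@teq_addN n)
    (@teq_scaleA n) (@teq_scale1 n) (@teq_scaleDr n) (@teq_scaleDl n).

Definition freeSp n : lmodType k := quotModule (freePre n).
Definition tcl n (x : term n) : freeSp n := qcl (x : pcar (freePre n)).

Lemma tclP n (x y : term n) : tcl x = tcl y <-> teq x y.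
Proof. exact: qclP. Qed.
Lemma tcl_surj n (a : freeSp n) : exists x, a = tcl x.
Proof. by exists (qrep a); rewrite /tcl qrepK. Qed.
Lemma tcl_add n (x y : term n) : tcl (TAdd x y) = tcl x + tcl y.
Proof. by rewrite /tcl -qclD. Qed.
Lemma tcl_scale n c (x : term n) : tcl (TScale c x) = c *: tcl x.
Proof. by rewrite /tcl -qclZ. Qed.
Lemma tcl_lin n c (x y : term n) :
  tcl (TAdd (TScale c x) y) = c *: tcl x + tcl y.
Proof. by rewrite tcl_add tcl_scale. Qed.
Lemma tcl_zero n : tcl (TZero n) = 0. Proof. by []. Qed.

Definition freeComp m n p (e : p = (m + n)%N) (i : 'I_m.+1)
    (a : freeSp m) (b : freeSp n) : freeSp p :=
  tcl (TComp e i (qrep a) (qrep b)).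

Lemma freeCompE m n p (e : p = (m + n)%N) i (x : term m) (y : term n) :
  freeComp e i (tcl x) (tcl y) = tcl (TComp e i x y).
Proof.
by apply/tclP/teq_comp; [apply: (@qrepP _ (freePre m)) | apply: (@qrepP _ (freePre n))].
Qed.

Program Definition freeOperad : nsOperad k :=
  @NsOperad k freeSp (tcl TId) freeComp _ _ _ _ _ _.
Next Obligation.
move=> m n p e i c a a' b.
have [[x ->] [x' ->] [y ->]] := And3 (tcl_surj a) (tcl_surj a') (tcl_surj b).
by rewrite -tcl_lin !freeCompE -tcl_lin; apply/tclP/teq_compDl.
Qed.
Next Obligation.
move=> m n p e i c a b b'.
have [[x ->] [y ->] [y' ->]] := And3 (tcl_surj a) (tcl_surj b) (tcl_surj b').
by rewrite -tcl_lin !freeCompE -tcl_lin; apply/tclP/teq_compDr.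
Qed.
Next Obligation.
by move=> n e a; have [x ->] := tcl_surj a; rewrite freeCompE; apply/tclP/teq_comp1l.
Qed.
Next Obligation.
by move=> n e i a; have [x ->] := tcl_surj a; rewrite freeCompE; apply/tclP/teq_comp1r.
Qed.
Next Obligation.
move=> m n q mn nq p e1 e2 e3 e4 i j h a b c hE.
have [[x ->] [y ->] [z ->]] := And3 (tcl_surj a) (tcl_surj b) (tcl_surj c).
by rewrite !freeCompE; apply/tclP/teq_compA.
Qed.
Next Obligation.
move=> m n q mn mq p e1 e2 e3 e4 i j h i' a b c ij hE iE.
have [[x ->] [y ->] [z ->]] := And3 (tcl_surj a) (tcl_surj b) (tcl_surj c).
by rewrite !freeCompE; apply/tclP/teq_compC.
Qed.

Definition freeGen (v : V) : freeOperad 1 := tcl (TGen v).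
Fact freeGen_lin : linear freeGen.
Proof.
by move=> c u v; rewrite /freeGen -tcl_lin; apply/tclP/teq_gen.
Qed.
HB.instance Definition _ := GRing.isLinear.Build k V (freeOperad 1) *:%R freeGen freeGen_lin.
End FreeOperad.

Section NsMorphisms.
Variable k : fieldType.

Record nsMorphism (P Q : nsOperad k) := NsMorphism {
  nsm_fun :> forall n, {linear P n -> Q n};
  nsm_id : nsm_fun 0 (ns_id P) = ns_id Q;
  nsm_comp : forall m n p (e : p = (m + n)%N) i a b,
    nsm_fun p (ns_comp P e i a b) = ns_comp Q e i (nsm_fun m a) (nsm_fun n b)
}.

Variables (V : lmodType k) (Q : nsOperad k) (g : {linear V -> Q 1}).

Fixpoint teval n (x : term V n) : Q n :=
  match x in term _ n return Q n with
  | TId => ns_id Q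
  | TGen v => g v
  | TComp _ _ _ e i x y => ns_comp Q e i (teval x) (teval y)
  | TZero _ => 0
  | TAdd _ x y => teval x + teval y
  | TScale _ c x => c *: teval x
  end.

Lemma teval_teq n (x y : term V n) : teq x y -> teval x = teval y.
Proof.
elim=> {n x y}/=.
- by [].
- by [].
- by move=> n x y z _ -> _ ->.
- by move=> n x x' y y' _ -> _ ->.
- by move=> n c x x' _ ->.
- by move=> m n p e i x x' y y' _ -> _ ->.
- by move=> *; rewrite addrA.
- by move=> *; rewrite addrC.
- by move=> *; rewrite add0r.
- by move=> *; rewrite scaleN1r addNr.
- by move=> *; rewrite scalerA.
- by move=> *; rewrite scale1r.
- by move=> *; rewrite scalerDr.
- by move=> *; rewrite scalerDl.
- by move=> *; rewrite linearP.
- by move=> *; rewrite ns_compDl.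
- by move=> *; rewrite ns_compDr.
- by move=> *; rewrite ns_comp1l.
- by move=> *; rewrite ns_comp1r.
- by move=> m n q mn nq p e1 e2 e3 e4 i j h x y z hE; apply: ns_compA.
- by move=> m n q mn mq p e1 e2 e3 e4 i j h i' x y z ij hE iE; apply: ns_compC.
Qed.

Definition freeExt_fun n (a : freeOperad V n) : Q n := teval (qrep a).
Lemma freeExt_tcl n (x : term V n) : freeExt_fun (tcl x) = teval x.
Proof. by apply: teval_teq; apply: (@qrepP _ (freePre V n)). Qed.
Fact freeExt_lin n : linear (@freeExt_fun n).
Proof.
move=> c a b; have [x ->] := tcl_surj a; have [y ->] := tcl_surj b.
by rewrite -tcl_lin !freeExt_tcl.
Qed.
HB.instance Definition _ n :=
  GRing.isLinear.Build k (freeOperad V n) (Q n) *:%R (@freeExt_fun n) (@freeExt_lin n).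

Program Definition freeExt : nsMorphism (freeOperad V) Q :=
  @NsMorphism _ _ (fun n => @freeExt_fun n) _ _.
Next Obligation. by rewrite /= [LHS]freeExt_tcl. Qed.
Next Obligation.
move=> m n p e i a b /=; have [x ->] := tcl_surj a; have [y ->] := tcl_surj b.
by rewrite freeCompE !freeExt_tcl.
Qed.

Lemma freeExt_gen v : freeExt 1%N (freeGen v) = g v.
Proof. exact: freeExt_tcl. Qed.

Lemma freeExt_unique (f : nsMorphism (freeOperad V) Q) :
  (forall v, f 1%N (freeGen v) = g v) -> forall n (a : freeOperad V n), f n a = freeExt n a.
Proof.
move=> fg n a; have [x {a}->] := tcl_surj a.
rewrite [RHS]freeExt_tcl; elim: x => {n}/=.
- exact: (nsm_id f).
- exact: fg.
- by move=> m n p e i x <- y <-; rewrite -(nsm_comp f e i (tcl x) (tcl y)) -freeCompE.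
- by move=> n; exact: linear0.
- by move=> n x <- y <-; rewrite tcl_add [LHS]linearD.
- by move=> n c x <-; rewrite tcl_scale [LHS]linearZ.
Qed.
End NsMorphisms.

(* An element s of 'S_n.+1 is read as the word s 0, ..., s n: a . s is the
   operation (x_0, ..., x_n) |-> a (x_(s 0), ..., x_(s n)).  Products of
   permutations compose from left to right, so this is a right action.  Input
   number s j of a . s is thus input number j of a. *)
Section BlockPermutation.
Variables (m n p : nat) (e : p = (m + n)%N).

(* The word obtained from s by substituting the word t, with its letters shifted
   by s j, for the letter s j; the letters of s above s j are shifted by n. *)
Definition block_fun (j : 'I_m.+1) (s : 'S_m.+1) (t : 'S_n.+1) (x : nat) : nat :=
  let shift y := if (y < s j)%N then y else (y + n)%N in
  if (x < j)%N then shift (s (inord x))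
  else if (x <= j + n)%N then (s j + t (inord (x - j)))%N
  else shift (s (inord (x - n))).

Lemma block_fun_lt j s t x : (x < p.+1)%N -> (block_fun j s t x < p.+1)%N.
Proof.
move=> xp; rewrite /block_fun.
have A y : (s y < m.+1)%N by [].
have B y : (t y < n.+1)%N by [].
have [Aj Bx] := (A j, B (inord (x - j))).
have [Ax Ay] := (A (inord x), A (inord (x - n))).
have jm := ltn_ord j.
case: ifP => _; [by case: ifP => _; lia | case: ifP => _; first by lia].
by case: ifP => _; lia.
Qed.

Lemma block_fun_inj j s t x y : (x < p.+1)%N -> (y < p.+1)%N ->
  block_fun j s t x = block_fun j s t y -> x = y.
Proof.
move=> xp yp.
have S a b : (a < m.+1)%N -> (b < m.+1)%N ->
    s (inord a) = s (inord b) :> nat -> a = b.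
  move=> am bm /val_inj/perm_inj/(congr1 val) /=; by rewrite !inordK.
have T a b : (a < n.+1)%N -> (b < n.+1)%N ->
    t (inord a) = t (inord b) :> nat -> a = b.
  move=> am bm /val_inj/perm_inj/(congr1 val) /=; by rewrite !inordK.
have S' a : (a < m.+1)%N -> a <> j -> s (inord a) <> s j :> nat.
  by move=> am aj; rewrite -[in s j](inord_val j) => /S -/(_ am (ltn_ord j)).
have Tb a := ltn_ord (t (inord a)).
have jm := ltn_ord j.
pose shift (u : nat) := if (u < s j)%N then u else (u + n)%N.
have shift_inj (u v : nat) : shift u = shift v -> u = v.
  by rewrite /shift; do 2!case: ifP; lia.
have shift_sep (u v : nat) : (v < n.+1)%N -> u <> s j :> nat -> shift u <> (s j + v)%N.
  by rewrite /shift => vn us; case: ifP => us' E; lia.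
rewrite /block_fun -/(shift _) -/(shift _) -/(shift _) -/(shift _).
case: (ltnP x j) => xj; [|case: (leqP x (j + n)) => xjn];
  (case: (ltnP y j) => yj; [|case: (leqP y (j + n)) => yjn]).
- by move/shift_inj/S; apply; lia.
- by move/shift_sep; case; [apply: Tb | apply: S'; lia].
- move/shift_inj/S => E; have : x = (y - n)%N by apply: E; lia.
  lia.
- by move/esym/shift_sep; case; [apply: Tb | apply: S'; lia].
- move/addnI/T => E; have : (x - j = y - j)%N by apply: E; lia.
  lia.
- by move/esym/shift_sep; case; [apply: Tb | apply: S'; lia].
- move/shift_inj/S => E; have : (x - n = y)%N by apply: E; lia.
  lia.
- by move/shift_sep; case; [apply: Tb | apply: S'; lia].
- move/shift_inj/S => E; have : (x - n = y - n)%N by apply: E; lia.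
  lia.
Qed.

Definition block_ord j s t (x : 'I_p.+1) : 'I_p.+1 :=
  Ordinal (block_fun_lt j s t (ltn_ord x)).
Lemma block_ord_inj j s t : injective (block_ord j s t).
Proof. by move=> x y /(congr1 val)/block_fun_inj E; apply/val_inj/E. Qed.
Definition block_perm j s t : 'S_p.+1 := perm (@block_ord_inj j s t).
End BlockPermutation.

Section BlockPermutationTheory.
Implicit Types m n p : nat.

Definition skip n (j y : nat) := if (y < j)%N then y else (y + n)%N.

Lemma block_permI m n p (e : p = (m + n)%N) (j : 'I_m.+1) s t (x : 'I_p.+1) (z : 'I_n.+1) :
  x = (j + z)%N :> nat -> block_perm e j s t x = (s j + t z)%N :> nat.
Proof.
move=> xE; rewrite permE /= /block_fun xE addKn inord_val.
rewrite ltnNge leq_addr /= leq_add2l.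
by rewrite -ltnS ltn_ord.
Qed.

Lemma block_permO m n p (e : p = (m + n)%N) (j : 'I_m.+1) s t (x : 'I_p.+1) (y : 'I_m.+1) :
  y != j -> x = skip n j y :> nat -> block_perm e j s t x = skip n (s j) (s y) :> nat.
Proof.
move=> yj; have yj' : y <> j :> nat by move=> /val_inj/eqP; rewrite (negPf yj).
rewrite permE /= /block_fun /skip; case: ifP => yj'' xE; rewrite xE.
  by rewrite yj'' inord_val.
have -> : (y + n < j)%N = false by lia.
have -> : (y + n <= j + n)%N = false by lia.
by rewrite addnK inord_val.
Qed.

Variant block_spec m n p (j : 'I_m.+1) (x : 'I_p.+1) : Prop :=
| BlockInner (z : 'I_n.+1) of x = (j + z)%N :> nat
| BlockOuter (y : 'I_m.+1) of y != j & x = skip n j y :> nat.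

Lemma block_permP m n p (e : p = (m + n)%N) (j : 'I_m.+1) (x : 'I_p.+1) :
  @block_spec m n p j x.
Proof.
have xp := ltn_ord x; have jm := ltn_ord j.
have neq (y : 'I_m.+1) : y <> j :> nat -> y != j.
  by move=> yj; apply/eqP => /(congr1 val).
case: (ltnP x j) => xj.
  apply: (@BlockOuter m n p j x (inord x)); first by apply: neq; rewrite inordK; lia.
  by rewrite /skip inordK; [case: ifP; lia | lia].
case: (leqP x (j + n)) => xjn.
  by apply: (@BlockInner m n p j x (inord (x - j))); rewrite inordK; lia.
apply: (@BlockOuter m n p j x (inord (x - n))); first by apply: neq; rewrite inordK; lia.
by rewrite /skip inordK; [case: ifP; lia | lia].
Qed.

Lemma perm_neq m (s : 'S_m) (x y : 'I_m) : x != y -> s x <> s y :> nat.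
Proof. by move=> /eqP xy /val_inj/perm_inj. Qed.

Lemma ord_neq m (x y : 'I_m) : x <> y :> nat -> x != y.
Proof. by move=> xy; apply/eqP => E; apply: xy; rewrite E. Qed.

Lemma block_perm1l n (e : n = (0 + n)%N) (s : 'S_1) (t : 'S_n.+1) :
  block_perm e ord0 s t = t.
Proof.
apply/permP => x; apply/val_inj; rewrite /= (@block_permI _ _ _ e ord0 s t x x) //.
by case: (s ord0) => -[].
Qed.

Lemma block_perm1r n (e : n = (n + 0)%N) j (s : 'S_n.+1) (t : 'S_1) :
  block_perm e j s t = s.
Proof.
have t0 z : t z = 0%N :> nat by case: (t z) => -[].
apply/permP => x; apply/val_inj => /=; have [z xE|y yj xE] := block_permP e j x.
  rewrite (block_permI e s t xE) t0 addn0; do 2?f_equal; apply/val_inj => /=.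
  by rewrite xE; case: (z) => -[] //=; lia.
rewrite (block_permO e s t yj xE) /skip addn0 if_same.
by congr (nat_of_ord (s _)); apply/val_inj; rewrite /= xE /skip addn0 if_same.
Qed.

Lemma block_permM m n p (e : p = (m + n)%N) (j : 'I_m.+1) (r s : 'S_m.+1) (t u : 'S_n.+1) :
  block_perm e j (r * s)%g (t * u)%g =
  (block_perm e j r t * block_perm e (r j) s u)%g.
Proof.
apply/permP => x; apply/val_inj; rewrite /= permM.
have [z xE|y yj xE] := block_permP e j x.
  rewrite (block_permI e _ _ xE) (@block_permI _ _ _ e (r j) s u _ (t z)) ?permM //.
  exact: block_permI.
rewrite (block_permO e _ _ yj xE) (@block_permO _ _ _ e (r j) s u _ (r y)) ?permM //.
  by rewrite (inj_eq perm_inj).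
exact: block_permO.
Qed.

Lemma block_permA m n q mn nq p (e1 : mn = (m + n)%N) (e2 : p = (mn + q)%N)
    (e3 : nq = (n + q)%N) (e4 : p = (m + nq)%N)
    (i : 'I_m.+1) (j : 'I_n.+1) (h : 'I_mn.+1) s t u :
  h = (i + j)%N :> nat ->
  block_perm e2 h (block_perm e1 i s t) u = block_perm e4 i s (block_perm e3 j t u).
Proof.
move=> hE; apply/permP => x; apply/val_inj => /=.
have BhE := block_permI e1 s t hE.
have jn := ltn_ord j; have tn := ltn_ord (t j).
have [z xE|y yh xE] := block_permP e2 h x.
  have zn := ltn_ord z.
  rewrite (block_permI e2 _ _ xE) BhE.
  have wE : (inord (j + z) : 'I_nq.+1) = (j + z)%N :> nat by rewrite inordK; lia.
  rewrite (@block_permI _ _ _ e4 i s _ x (inord (j + z))); last by rewrite wE; lia.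
  by rewrite (block_permI e3 _ _ wE); lia.
rewrite (block_permO e2 _ _ yh xE) BhE.
have [z yE|y' y'i yE] := block_permP e1 i y.
  have zj : z <> j :> nat by move=> E; case/eqP: yh; apply/val_inj => /=; lia.
  have zj' := ord_neq zj; have tzj := @perm_neq _ t _ _ zj'; have zn := ltn_ord z.
  rewrite (block_permI e1 s t yE).
  have wE : (inord (skip q j z) : 'I_nq.+1) = skip q j z :> nat.
    by rewrite inordK // /skip; case: ifP; lia.
  rewrite (@block_permI _ _ _ e4 i s _ x (inord (skip q j z))); last first.
    by rewrite wE xE /skip hE yE; do 2!case: ifP; lia.
  by rewrite (block_permO e3 _ _ zj' wE) /skip; do 2!case: ifP; lia.
have sy'i := @perm_neq _ s _ _ y'i.
have y'i' : y' <> i :> nat by move=> /val_inj/eqP; rewrite (negPf y'i).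
rewrite (block_permO e1 s t y'i yE).
rewrite (@block_permO _ _ _ e4 i s _ x y') //.
  by rewrite /skip; case: (ltnP (s y') (s i)) => ?; case: ifP; lia.
by rewrite xE /skip hE yE /skip; case: (ltnP y' i) => ?; case: ifP; lia.
Qed.

Lemma skip_skip n q (i j y : nat) : i <> j -> y <> i -> y <> j ->
  skip q (skip n i j) (skip n i y) = skip n (skip q j i) (skip q j y).
Proof.
move=> ij yi yj; rewrite /skip.
case: (ltnP i j) => ij'; case: (ltnP j i) => ji'; try (exfalso; lia).
all: case: (ltnP y i) => yi'; case: (ltnP y j) => yj'; do ?case: ifP; lia.
Qed.

Lemma block_permC m n q mn mq p (e1 : mn = (m + n)%N) (e2 : p = (mn + q)%N)
    (e3 : mq = (m + q)%N) (e4 : p = (mq + n)%N)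
    (i j : 'I_m.+1) (h : 'I_mn.+1) (i' : 'I_mq.+1) s t u :
  i != j -> h = skip n i j :> nat -> i' = skip q j i :> nat ->
  block_perm e2 h (block_perm e1 i s t) u = block_perm e4 i' (block_perm e3 j s u) t.
Proof.
move=> ij hE iE; apply/permP => x; apply/val_inj => /=.
have ji : j != i by rewrite eq_sym.
have ij' : i <> j :> nat by move=> /val_inj/eqP; rewrite (negPf ij).
have sij := @perm_neq _ s _ _ ij.
have BhE := block_permO e1 s t ji hE.
have BiE := block_permO e3 s u ij iE.
have im := ltn_ord i; have jm := ltn_ord j.
have [z xE|y yh xE] := block_permP e2 h x.
  have zq := ltn_ord z; have uq := ltn_ord (u z).
  rewrite (block_permI e2 _ _ xE) BhE.
  have wE : (inord (j + z) : 'I_mq.+1) = (j + z)%N :> nat by rewrite inordK; lia.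
  rewrite (@block_permO _ _ _ e4 i' _ t x (inord (j + z))).
  - rewrite (block_permI e3 _ _ wE) BiE /skip.
    by case: (ltnP (s i) (s j)) => ?; case: (ltnP (s j) (s i)) => ?; case: ifP; lia.
  - by apply: ord_neq; rewrite wE iE /skip; case: ifP; lia.
  - rewrite xE hE wE iE /skip.
    by case: (ltnP i j) => ?; case: (ltnP j i) => ?; case: ifP; lia.
rewrite (block_permO e2 _ _ yh xE) BhE.
have yh' : y <> h :> nat by move=> /val_inj/eqP; rewrite (negPf yh).
have [z yE|y' y'i yE] := block_permP e1 i y.
  have zn := ltn_ord z; have tn := ltn_ord (t z).
  rewrite (block_permI e1 s t yE) (@block_permI _ _ _ e4 i' _ t x z).
    rewrite BiE /skip.
    by case: (ltnP (s i) (s j)) => ?; case: (ltnP (s j) (s i)) => ?; case: ifP; lia.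
  rewrite xE hE yE iE /skip.
  by case: (ltnP i j) => ?; case: (ltnP j i) => ?; case: ifP; lia.
have y'i' : y' <> i :> nat by move=> /val_inj/eqP; rewrite (negPf y'i).
have y'j' : y' <> j :> nat.
  by move=> E; apply: yh'; rewrite yE hE E.
have y'j := ord_neq y'j'.
have sy'i := @perm_neq _ s _ _ y'i; have sy'j := @perm_neq _ s _ _ y'j.
have y'm := ltn_ord y'.
rewrite (block_permO e1 s t y'i yE).
have wE : (inord (skip q j y') : 'I_mq.+1) = skip q j y' :> nat.
  by rewrite inordK // /skip; case: ifP; lia.
rewrite (@block_permO _ _ _ e4 i' _ t x (inord (skip q j y'))).
- by rewrite (block_permO e3 _ _ y'j wE) BiE skip_skip.
- apply: ord_neq; rewrite wE iE /skip.
  by case: (ltnP i j) => ?; case: (ltnP y' j) => ?; lia.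
- by rewrite xE hE yE wE iE skip_skip.
Qed.
End BlockPermutationTheory.

(* A symmetric operad is presented by its underlying non-symmetric operad
   together with the right actions of the symmetric groups. *)
Record operad (k : fieldType) := Operad {
  op_ns :> nsOperad k;
  op_act : forall n, op_ns n -> 'S_n.+1 -> op_ns n;
  op_act_lin : forall n c (a b : op_ns n) s,
    op_act (c *: a + b) s = c *: op_act a s + op_act b s;
  op_act1 : forall n (a : op_ns n), op_act a 1%g = a;
  op_actM : forall n (a : op_ns n) s t, op_act (op_act a s) t = op_act a (s * t)%g;
  op_equivariance : forall m n p (e : p = (m + n)%N) (j : 'I_m.+1)
      (a : op_ns m) (b : op_ns n) (s : 'S_m.+1) (t : 'S_n.+1),
    ns_comp op_ns e (s j) (op_act a s) (op_act b t) =
    op_act (ns_comp op_ns e j a b) (block_perm e j s t)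
}.
Arguments op_act {k} _ {n} _ _.

Section Regular.
Variables (k : fieldType) (P : nsOperad k).

(* P n (x) k[S_(n+1)], with f standing for the sum of the f s (x) s. *)
Definition regSp n : lmodType k := {ffun 'S_n.+1 -> P n}.

Definition regTens n (a : P n) (s : 'S_n.+1) : regSp n :=
  [ffun t => if t == s then a else 0].

Lemma regTens_lin n c (a b : P n) s :
  regTens (c *: a + b) s = c *: regTens a s + regTens b s.
Proof.
by apply/ffunP=> t; rewrite !ffunE; case: ifP; rewrite // scaler0 addr0.
Qed.
Lemma regTens0 n s : regTens (0 : P n) s = 0.
Proof. by apply/ffunP=> t; rewrite !ffunE if_same. Qed.
Lemma regTens_sum n (f : regSp n) : f = \sum_s regTens (f s) s.
Proof.
apply/ffunP=> t; rewrite sum_ffunE (bigD1 t) //= ffunE eqxx big1 ?addr0 // => s st.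
by rewrite ffunE eq_sym (negPf st).
Qed.

(* The bilinear extension of the block composition
   (a (x) s) o_i (b (x) t) = (a o_j b) (x) (s o_j t), where s j = i. *)
Definition regComp m n p (e : p = (m + n)%N) (i : 'I_m.+1)
    (f : regSp m) (g : regSp n) : regSp p :=
  \sum_(s : 'S_m.+1) \sum_(t : 'S_n.+1) let j := (s^-1)%g i in
    regTens (ns_comp P e j (f s) (g t)) (block_perm e j s t).

Definition regAct n (f : regSp n) (u : 'S_n.+1) : regSp n :=
  \sum_(s : 'S_n.+1) regTens (f s) (s * u)%g.

Lemma regComp_linl m n p (e : p = (m + n)%N) i c f f' g :
  @regComp m n p e i (c *: f + f') g = c *: regComp e i f g + regComp e i f' g.
Proof.
rewrite /regComp scaler_sumr -big_split; apply: eq_bigr => s _ /=.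
rewrite scaler_sumr -big_split; apply: eq_bigr => t _ /=.
by rewrite !ffunE ns_compDl regTens_lin.
Qed.
Lemma regComp_linr m n p (e : p = (m + n)%N) i c f g g' :
  @regComp m n p e i f (c *: g + g') = c *: regComp e i f g + regComp e i f g'.
Proof.
rewrite /regComp scaler_sumr -big_split; apply: eq_bigr => s _ /=.
rewrite scaler_sumr -big_split; apply: eq_bigr => t _ /=.
by rewrite !ffunE ns_compDr regTens_lin.
Qed.
Lemma regComp0l m n p (e : p = (m + n)%N) i g : @regComp m n p e i 0 g = 0.
Proof. by have := regComp_linl e i (-1) 0 0 g; rewrite !scaleN1r oppr0 addr0 addNr. Qed.
Lemma regComp0r m n p (e : p = (m + n)%N) i f : @regComp m n p e i f 0 = 0.
Proof. by have := regComp_linr e i (-1) f 0 0; rewrite !scaleN1r oppr0 addr0 addNr. Qed.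
Lemma regComp_suml m n p (e : p = (m + n)%N) i I r (C : pred I) F g :
  @regComp m n p e i (\sum_(x <- r | C x) F x) g = \sum_(x <- r | C x) regComp e i (F x) g.
Proof.
apply: (big_morph (fun f => regComp e i f g)); last exact: regComp0l.
by move=> f f'; rewrite -[f in LHS]scale1r regComp_linl scale1r.
Qed.
Lemma regComp_sumr m n p (e : p = (m + n)%N) i I r (C : pred I) f F :
  @regComp m n p e i f (\sum_(x <- r | C x) F x) = \sum_(x <- r | C x) regComp e i f (F x).
Proof.
apply: (big_morph (fun g => regComp e i f g)); last exact: regComp0r.
by move=> g g'; rewrite -[g in LHS]scale1r regComp_linr scale1r.
Qed.

Lemma regCompE m n p (e : p = (m + n)%N) i (a : P m) (s : 'S_m.+1) (b : P n) t :
  let j := (s^-1)%g i in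
  regComp e i (regTens a s) (regTens b t) =
  regTens (ns_comp P e j a b) (block_perm e j s t).
Proof.
rewrite /regComp (bigD1 s) //= [X in _ + X]big1 ?addr0 => [|s' s's]; last first.
  by rewrite big1 // => t' _; rewrite !ffunE (negPf s's) ns_comp0l regTens0.
rewrite (bigD1 t) //= big1 ?addr0 => [|t' t't]; first by rewrite !ffunE !eqxx.
by rewrite [regTens b t t']ffunE (negPf t't) ns_comp0r regTens0.
Qed.

Lemma regAct_lin n c (f g : regSp n) u :
  regAct (c *: f + g) u = c *: regAct f u + regAct g u.
Proof.
rewrite /regAct scaler_sumr -big_split; apply: eq_bigr => s _ /=.
by rewrite !ffunE regTens_lin.
Qed.
Lemma regAct0 n u : regAct (0 : regSp n) u = 0.
Proof. by have := regAct_lin (-1) 0 0 u; rewrite !scaleN1r oppr0 addr0 addNr. Qed.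
Lemma regAct_sum n I r (C : pred I) F u :
  @regAct n (\sum_(x <- r | C x) F x) u = \sum_(x <- r | C x) regAct (F x) u.
Proof.
apply: (big_morph (fun f => regAct f u)); last exact: regAct0.
by move=> f f'; rewrite -[f in LHS]scale1r regAct_lin scale1r.
Qed.
Lemma regActE n (a : P n) (s u : 'S_n.+1) : regAct (regTens a s) u = regTens a (s * u)%g.
Proof.
rewrite /regAct (bigD1 s) //= ffunE eqxx big1 ?addr0 // => s' s's.
by rewrite ffunE (negPf s's) regTens0.
Qed.

Lemma regInd n (C : regSp n -> Prop) :
  C 0 -> (forall f g, C f -> C g -> C (f + g)) -> (forall a s, C (regTens a s)) ->
  forall f, C f.
Proof. by move=> C0 CD CT f; rewrite [f]regTens_sum; apply: big_ind. Qed.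

Lemma regCompDl m n p (e : p = (m + n)%N) i f f' g :
  @regComp m n p e i (f + f') g = regComp e i f g + regComp e i f' g.
Proof. by rewrite -[f in LHS]scale1r regComp_linl scale1r. Qed.
Lemma regCompDr m n p (e : p = (m + n)%N) i f g g' :
  @regComp m n p e i f (g + g') = regComp e i f g + regComp e i f g'.
Proof. by rewrite -[g in LHS]scale1r regComp_linr scale1r. Qed.
Lemma regActD n (f g : regSp n) u : regAct (f + g) u = regAct f u + regAct g u.
Proof. by rewrite -[f in LHS]scale1r regAct_lin scale1r. Qed.

Program Definition regNsOperad : nsOperad k :=
  @NsOperad k regSp (regTens (ns_id P) 1%g) regComp regComp_linl regComp_linr _ _ _ _.
Next Obligation.
move=> n e f; elim/regInd: f => [|f g IHf IHg|a s]; first exact: regComp0r.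
  by rewrite regCompDr IHf IHg.
rewrite regCompE invg1 perm1 block_perm1l; congr regTens.
exact: ns_comp1l.
Qed.
Next Obligation.
move=> n e i f; elim/regInd: f => [|f g IHf IHg|a s]; first exact: regComp0l.
  by rewrite regCompDl IHf IHg.
by rewrite regCompE block_perm1r; congr regTens; apply: ns_comp1r.
Qed.
Next Obligation.
move=> m n q mn nq p e1 e2 e3 e4 i j h f g l hE.
elim/regInd: f => [|f f' IH IH'|a s]; first by rewrite !regComp0l.
  by rewrite !regCompDl IH IH'.
elim/regInd: g => [|g g' IH IH'|b t]; first by rewrite regComp0r !regComp0l regComp0r.
  by rewrite regCompDr !regCompDl regCompDr IH IH'.
elim/regInd: l => [|l l' IH IH'|c u]; first by rewrite !regComp0r.
  by rewrite !regCompDr IH IH'.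
rewrite !regCompE; set i' := (s^-1)%g i; set j' := (t^-1)%g j.
have im := ltn_ord i'; have jn := ltn_ord j'.
pose w : 'I_mn.+1 := inord (i' + j').
have wE : w = (i' + j')%N :> nat by rewrite inordK; lia.
have -> : ((block_perm e1 i' s t)^-1)%g h = w.
  apply: (canLR (permK _)); apply/val_inj => /=.
  by rewrite (block_permI e1 s t wE) !permKV hE.
rewrite (ns_compA e1 e2 e3 e4 _ _ _ wE).
by rewrite (block_permA e1 e2 e3 e4 _ _ _ wE).
Qed.
Next Obligation.
move=> m n q mn mq p e1 e2 e3 e4 i j h i0 f g l ij hE iE.
elim/regInd: f => [|f f' IH IH'|a s]; first by rewrite !regComp0l.
  by rewrite !regCompDl IH IH'.
elim/regInd: g => [|g g' IH IH'|b t]; first by rewrite !(regComp0r, regComp0l).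
  by rewrite !(regCompDr, regCompDl) IH IH'.
elim/regInd: l => [|l l' IH IH'|c u]; first by rewrite !(regComp0r, regComp0l).
  by rewrite !(regCompDr, regCompDl) IH IH'.
rewrite !regCompE; set i' := (s^-1)%g i; set j' := (s^-1)%g j.
have siE : s i' = i by rewrite permKV.
have sjE : s j' = j by rewrite permKV.
have ij' : i' != j' by rewrite (inj_eq perm_inj); apply/ord_neq; lia.
have ji' : j' != i' by rewrite eq_sym.
have ijn : i' <> j' :> nat by move=> /val_inj/eqP; rewrite (negPf ij').
have im := ltn_ord i'; have jm := ltn_ord j'.
pose w : 'I_mn.+1 := inord (skip n i' j').
pose v : 'I_mq.+1 := inord (skip q j' i').
have wE : w = skip n i' j' :> nat by rewrite inordK // /skip; case: ifP; lia.
have vE : v = skip q j' i' :> nat by rewrite inordK // /skip; case: ifP; lia.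
have -> : ((block_perm e1 i' s t)^-1)%g h = w.
  apply: (canLR (permK _)); apply/val_inj => /=.
  by rewrite (block_permO e1 s t ji' wE) siE sjE hE /skip; case: ifP; lia.
have -> : ((block_perm e3 j' s u)^-1)%g i0 = v.
  apply: (canLR (permK _)); apply/val_inj => /=.
  by rewrite (block_permO e3 s u ij' vE) siE sjE iE /skip; case: ifP; lia.
rewrite (block_permC e1 e2 e3 e4 _ _ _ ij' wE vE); congr regTens.
move: wE vE; rewrite /skip; case: (ltnP i' j') => [lt_ij|le_ji].
  have -> : (j' < i')%N = false by lia.
  by move=> wE vE; apply: ns_compC.
have -> : (j' < i')%N by lia.
by move=> wE vE; apply/esym/ns_compC => //; lia.
Qed.

(* The functor Sigma from non-symmetric to regular operads. *)
Program Definition Sigma : operad k := @Operad k regNsOperad regAct regAct_lin _ _ _.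
Next Obligation.
move=> n f; elim/regInd: f => [|f g IHf IHg|a s]; first exact: regAct0.
  by rewrite regActD IHf IHg.
by rewrite regActE mulg1.
Qed.
Next Obligation.
move=> n f s t; elim/regInd: f => [|f g IHf IHg|a u]; first by rewrite !regAct0.
  by rewrite !regActD IHf IHg.
by rewrite !regActE mulgA.
Qed.
Next Obligation.
move=> m n p e j f g s t /=.
elim/regInd: f => [|f f' IH IH'|a r]; first by rewrite !(regAct0, regComp0l).
  by rewrite !(regActD, regCompDl) IH IH'.
elim/regInd: g => [|g g' IH IH'|b u]; first by rewrite !(regAct0, regComp0r).
  by rewrite !(regActD, regCompDr) IH IH'.
rewrite !(regActE, regCompE) invMg permM permK.
by rewrite block_permM permKV.
Qed.
End Regular.

Record operad_iso (k : fieldType) (P Q : operad k) := OperadIso {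
  iso_fun :> forall n, {linear P n -> Q n};
  iso_bij : forall n, bijective (iso_fun n);
  iso_id : iso_fun 0 (ns_id P) = ns_id Q;
  iso_comp : forall m n p (e : p = (m + n)%N) i a b,
    iso_fun p (ns_comp P e i a b) = ns_comp Q e i (iso_fun m a) (iso_fun n b);
  iso_act : forall n a s, iso_fun n (op_act P a s) = op_act Q (iso_fun n a) s
}.

Section TensorProduct.
Variable k : fieldType.
Implicit Types V W : vectType k.

Definition dual V : vectType k := 'Hom(V, k^o).

(* For finite dimensional V, the tensor product V (x) W is the space of linear
   maps from V^* to W, with v (x) w acting as z |-> z(v) w. *)
Definition tens V W : vectType k := 'Hom(dual V, W).

Definition tprod V W (v : V) (w : W) : tens V W :=
  linfun (fun z : dual V => (z v : k) *: w).

Definition dbasis V (i : 'I_(\dim {:V})) : dual V :=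
  linfun (fun v => coord (vbasis {:V}) i v : k^o).

(* The linear extension to V (x) W of a bilinear map B. *)
Definition tlift V W (U : lmodType k) (B : V -> W -> U) (x : tens V W) : U :=
  \sum_i \sum_j coord (vbasis {:W}) j (x (dbasis i)) *:
    B (vbasis {:V})`_i (vbasis {:W})`_j.

Fact tlift_lin V W U B : linear (@tlift V W U B).
Proof.
move=> c x y; rewrite /tlift scaler_sumr -big_split; apply: eq_bigr => i _ /=.
rewrite scaler_sumr -big_split; apply: eq_bigr => j _ /=.
by rewrite add_lfunE scale_lfunE linearP scalerDl scalerA.
Qed.
HB.instance Definition _ V W (U : lmodType k) (B : V -> W -> U) :=
  GRing.isLinear.Build k (tens V W) U *:%R (@tlift V W U B) (@tlift_lin V W U B).

Definition bilinear V W (U : lmodType k) (B : V -> W -> U) :=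
  (forall w, linear (B^~ w)) /\ (forall v, linear (B v)).

Lemma dbasisE V i v : @dbasis V i v = coord (vbasis {:V}) i v.
Proof. by rewrite lfunE. Qed.

Fact tprod_aux_lin V W (v : V) (w : W) : linear (fun z : dual V => (z v : k) *: w).
Proof. by move=> c z z'; rewrite add_lfunE scale_lfunE scalerDl scalerA. Qed.

Lemma tprodE V W (v : V) (w : W) z : tprod v w z = (z v : k) *: w.
Proof.
pose f := HB.pack_for {linear dual V -> W} (fun z : dual V => (z v : k) *: w)
  (GRing.isLinear.Build k (dual V) W *:%R _ (tprod_aux_lin v w)).
exact: (lfunE f z).
Qed.

Lemma tprod_bilinear V W : bilinear (@tprod V W).
Proof.
split=> [w c v v'|v c w w']; apply/lfunP => z.
  by rewrite add_lfunE scale_lfunE !tprodE linearP scalerDl scalerA.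
by rewrite add_lfunE scale_lfunE !tprodE scalerDr !scalerA mulrC.
Qed.

Lemma bilinear_suml V W U B : @bilinear V W U B -> forall I r (C : pred I) F w,
  B (\sum_(x <- r | C x) F x) w = \sum_(x <- r | C x) B (F x) w.
Proof.
case=> Bl _ I r C F w; apply: (big_morph (B^~ w)).
  by move=> v v'; rewrite -[v in LHS]scale1r Bl scale1r.
by have := Bl w (-1) 0 0; rewrite !scaleN1r oppr0 addr0 addNr.
Qed.
Lemma bilinear_sumr V W U B : @bilinear V W U B -> forall I r (C : pred I) F v,
  B v (\sum_(x <- r | C x) F x) = \sum_(x <- r | C x) B v (F x).
Proof.
case=> _ Br I r C F v; apply: (big_morph (B v)).
  by move=> w w'; rewrite -[w in LHS]scale1r Br scale1r.
by have := Br v (-1) 0 0; rewrite !scaleN1r oppr0 addr0 addNr.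
Qed.
Lemma bilinearZl V W U B : @bilinear V W U B -> forall c v w, B (c *: v) w = c *: B v w.
Proof.
move=> BB c v w; have B0 : B 0 w = 0 by have := bilinear_suml BB [::] xpredT id w; rewrite !big_nil.
by rewrite -[c *: v]addr0 BB.1 B0 addr0.
Qed.
Lemma bilinearZr V W U B : @bilinear V W U B -> forall c v w, B v (c *: w) = c *: B v w.
Proof.
move=> BB c v w; have B0 : B v 0 = 0 by have := bilinear_sumr BB [::] xpredT id v; rewrite !big_nil.
by rewrite -[c *: w]addr0 BB.2 B0 addr0.
Qed.

Lemma tliftE V W U B v w : @bilinear V W U B -> tlift B (tprod v w) = B v w.
Proof.
move=> BB; rewrite [in RHS](coord_vbasis (memvf v)) (bilinear_suml BB).
apply: eq_bigr => i _; rewrite [in RHS](coord_vbasis (memvf w)) (bilinear_sumr BB).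
apply: eq_bigr => j _.
by rewrite (bilinearZl BB) (bilinearZr BB) tprodE dbasisE linearZ /= scalerA.
Qed.

Lemma tens_decomp V W (x : tens V W) :
  x = \sum_i \sum_j coord (vbasis {:W}) j (x (dbasis i)) *:
    tprod (vbasis {:V})`_i (vbasis {:W})`_j.
Proof.
apply/lfunP => z; rewrite sum_lfunE.
have zE : z = \sum_(i < \dim {:V}) (z (vbasis {:V})`_i : k) *: dbasis i.
  apply/lfunP => v; rewrite [in LHS](coord_vbasis (memvf v)) linear_sum sum_lfunE /=.
  by apply: eq_bigr => i _; rewrite scale_lfunE dbasisE linearZ; apply: mulrC.
rewrite [in LHS]zE linear_sum; apply: eq_bigr => i _.
rewrite linearZ /= sum_lfunE [in LHS](coord_vbasis (memvf (x _))).
rewrite scaler_sumr; apply: eq_bigr => j _.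
by rewrite scale_lfunE tprodE !scalerA mulrC.
Qed.

Lemma tlift_unique V W (U : lmodType k) (f g : {linear tens V W -> U}) :
  (forall v w, f (tprod v w) = g (tprod v w)) -> f =1 g.
Proof.
move=> fg x; rewrite [x]tens_decomp !linear_sum; apply: eq_bigr => i _.
by rewrite !linear_sum; apply: eq_bigr => j _; rewrite !linearZ /= fg.
Qed.

(* The subspace U1 (x) U2. *)
Definition tensv V W (U1 : {vspace V}) (U2 : {vspace W}) : {vspace tens V W} :=
  <<[seq tprod u w | u <- vbasis U1, w <- vbasis U2]>>%VS.

Lemma mem_tensv V W (U1 : {vspace V}) (U2 : {vspace W}) u w :
  u \in U1 -> w \in U2 -> tprod u w \in tensv U1 U2.
Proof.
move=> uU wU; rewrite (coord_vbasis uU) (bilinear_suml (@tprod_bilinear V W)).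
apply: memv_suml => i _; rewrite (coord_vbasis wU) (bilinear_sumr (@tprod_bilinear V W)).
apply: memv_suml => j _.
rewrite (bilinearZl (@tprod_bilinear V W)) (bilinearZr (@tprod_bilinear V W)).
do 2!apply: memvZ; apply/memv_span/allpairsP; exists ((vbasis U1)`_i, (vbasis U2)`_j).
by split=> //; apply: mem_nth; rewrite size_tuple.
Qed.

(* The functional v (x) w |-> z(v) y(w). *)
Definition dual_tens V W (z : dual V) (y : dual W) : dual (tens V W) :=
  linfun (tlift (fun v w => (z v : k) * y w : k^o)).

Definition tpair V W (x : tens V W) (y : tens (dual V) (dual W)) : k :=
  tlift (fun z y => dual_tens z y x : k^o) y.
End TensorProduct.

Section QuadraticData.
Variable k : fieldType.
Implicit Types V W : vectType k.

(* F(V)(3), as (V (x) V) (+) (V (x) V): see quad_free and quad_free_bij. *)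
Definition quad V : vectType k := (tens V V * tens V V)%type.
Definition circ1 V (u v : V) : quad V := (tprod u v, 0).
Definition circ2 V (u v : V) : quad V := (0, tprod u v).

Definition qpair V (x : quad V) (y : quad (dual V)) : k :=
  tpair x.1 y.1 - tpair x.2 y.2.

Definition qform V (x : quad V) : dual (quad (dual V)) :=
  linfun (fun y => qpair x y : k^o).

Definition orth V (R : {vspace quad V}) : {vspace quad (dual V)} :=
  (\bigcap_(i < \dim R) lker (qform (vbasis R)`_i))%VS.

Definition Phi V W : 'Hom(quad (tens V W), tens (quad V) (quad W)) :=
  linfun (fun x : quad (tens V W) =>
    tlift (fun a b => tlift (fun u u' => tlift (fun v v' =>
      tprod (circ1 u v) (circ1 u' v')) b) a) x.1 +
    tlift (fun a b => tlift (fun u u' => tlift (fun v v' =>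
      tprod (circ2 u v) (circ2 u' v')) b) a) x.2).

Definition Psi V W : 'Hom(tens (quad V) (quad W), quad (tens V W)) :=
  linfun (tlift (fun (x : quad V) (y : quad W) =>
    tlift (fun u v => tlift (fun u' v' =>
      circ1 (tprod u u') (tprod v v')) y.1) x.1 -
    tlift (fun u v => tlift (fun u' v' =>
      circ2 (tprod u u') (tprod v v')) y.2) x.2)).
End QuadraticData.

Section QuadraticDataTheory.
Variable k : fieldType.
Implicit Types V W : vectType k.

Lemma linfunE (V W : vectType k) (f : V -> W) : linear f -> linfun f =1 f.
Proof.
move=> f_lin x.
pose g := HB.pack_for {linear V -> W} f (GRing.isLinear.Build k V W *:%R f f_lin).
exact: (lfunE g x).
Qed.

Lemma tlift_par V W (A U : lmodType k) (B : A -> V -> W -> U) x :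
  (forall v w, linear (fun a => B a v w)) -> linear (fun a => tlift (B a) x).
Proof.
move=> B_lin c a a'; rewrite /tlift scaler_sumr -big_split; apply: eq_bigr => i _ /=.
rewrite scaler_sumr -big_split; apply: eq_bigr => j _ /=.
by rewrite B_lin scalerDr !scalerA mulrC.
Qed.

Lemma subr_lin (U : lmodType k) c (a a' b b' : U) :
  (c *: a + a') - (c *: b + b') = c *: (a - b) + (a' - b').
Proof. by rewrite opprD addrACA scalerBr. Qed.

Lemma dual_tensE V W (z : dual V) (y : dual W) v w :
  dual_tens z y (tprod v w) = (z v : k) * y w.
Proof.
rewrite linfunE; last by move=> c x x'; rewrite linearP.
rewrite tliftE //; split=> [b c a a'|a c b b'] /=.
  by rewrite linearP mulrDl -mulrA.
by rewrite linearP mulrDr mulrCA.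
Qed.

Lemma dual_tens_bilinear V W : bilinear (@dual_tens k V W).
Proof.
split=> [y c z z'|z c y y']; apply/lfunP.
  apply: tlift_unique => v w /=.
  by rewrite add_lfunE scale_lfunE !dual_tensE add_lfunE scale_lfunE mulrDl -mulrA.
apply: tlift_unique => v w /=.
by rewrite add_lfunE scale_lfunE !dual_tensE add_lfunE scale_lfunE mulrDr mulrCA.
Qed.

Lemma tpairE V W (u : V) (w : W) z y :
  tpair (tprod u w) (tprod z y) = (z u : k) * y w.
Proof.
rewrite /tpair tliftE ?dual_tensE //.
have [Dl Dr] := dual_tens_bilinear V W.
by split=> [b c a a'|a c b b'] /=; rewrite ?Dl ?Dr add_lfunE scale_lfunE.
Qed.

Lemma tpair_linr V W (x : tens V W) : linear (fun y => tpair x y : k^o).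
Proof. by move=> c y y'; rewrite /tpair linearP. Qed.
Lemma tpair_linl V W (y : tens (dual V) (dual W)) : linear (fun x => tpair x y : k^o).
Proof. by apply: tlift_par => z t c x x'; rewrite linearP. Qed.

Lemma qpair_linr V (x : quad V) : linear (fun y => qpair x y : k^o).
Proof.
move=> c y y'; rewrite /qpair /= !tpair_linr scalerBr opprD.
by rewrite [LHS]addrACA.
Qed.
Lemma qpair_linl V (y : quad (dual V)) : linear (fun x => qpair x y : k^o).
Proof.
move=> c x x'; rewrite /qpair /= !tpair_linl scalerBr opprD.
by rewrite [LHS]addrACA.
Qed.

Lemma qformE V (x : quad V) y : qform x y = qpair x y.
Proof. exact: (linfunE (qpair_linr x)). Qed.

Lemma orthP V (R : {vspace quad V}) y :
  reflect (forall x, x \in R -> qpair x y = 0) (y \in orth R).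
Proof.
have memE : (y \in orth R) = [forall i : 'I_(\dim R), qpair (vbasis R)`_i y == 0].
  rewrite /orth memvE; apply/subv_bigcapP/forallP => yR i.
    by have := yR i isT; rewrite -memvE memv_ker qformE.
  by move=> _; have := yR i; rewrite -memvE memv_ker qformE.
rewrite memE; apply: (iffP forallP) => [y0 x xR|y0 i]; last first.
  by apply/eqP/y0/vbasis_mem/mem_nth; rewrite size_tuple.
pose f := HB.pack_for {linear quad V -> k^o} (fun x => qpair x y : k^o)
  (GRing.isLinear.Build k (quad V) k^o *:%R _ (qpair_linl y)).
rewrite -[qpair x y]/(f x) (coord_vbasis xR) linear_sum big1 // => i _.
by rewrite linearZ /= (eqP (y0 i)) scaler0.
Qed.

Lemma circ1_bilinear V : bilinear (@circ1 k V).
Proof.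
split=> [v c u u'|u c v v']; rewrite /circ1 ?(tprod_bilinear V V).1 ?(tprod_bilinear V V).2;
by apply/pair_equal_spec; rewrite /= scaler0 addr0.
Qed.
Lemma circ2_bilinear V : bilinear (@circ2 k V).
Proof.
split=> [v c u u'|u c v v']; rewrite /circ2 ?(tprod_bilinear V V).1 ?(tprod_bilinear V V).2;
by apply/pair_equal_spec; rewrite /= scaler0 addr0.
Qed.

Definition multilinear4 (A B C D U : lmodType k) (M : A -> B -> C -> D -> U) :=
  [/\ forall b c d, linear (fun a => M a b c d), forall a c d, linear (fun b => M a b c d),
      forall a b d, linear (fun c => M a b c d) & forall a b c, linear (fun d => M a b c d)].

Lemma tlift_nested (A B C D : vectType k) (U : lmodType k) (M : A -> B -> C -> D -> U) a b c d :
  multilinear4 M ->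
  tlift (fun a b => tlift (M a b) (tprod c d)) (tprod a b) = M a b c d.
Proof.
case=> Ma Mb Mc Md; rewrite !tliftE //.
by split=> [b'|a']; apply: tlift_par => *; [apply: Ma | apply: Mb].
Qed.

Lemma tlift_tlift (A B C D : vectType k) (U : lmodType k) (M : A -> B -> C -> D -> U) a b c d :
  multilinear4 M ->
  tlift (fun x y => tlift (fun a b => tlift (M a b) y) x) (tprod (tprod a b) (tprod c d)) =
  M a b c d.
Proof.
move=> M4; rewrite tliftE; first exact: tlift_nested.
split=> [y|x]; first by move=> e x x'; rewrite linearP.
by apply: tlift_par => a' b' e y y'; rewrite linearP.
Qed.

Lemma tprod_multilinear4 (A B A' B' X Y : vectType k) (f : A -> B -> X) (g : A' -> B' -> Y) :
  bilinear f -> bilinear g -> multilinear4 (fun u u' v v' => tprod (f u v) (g u' v')).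
Proof.
case=> f1 f2 [g1 g2]; have [t1 t2] := tprod_bilinear X Y; split=> x y z c w w' /=.
- by rewrite f1 t1.
- by rewrite g1 t2.
- by rewrite f2 t1.
- by rewrite g2 t2.
Qed.

Lemma circ_multilinear4 V W (f : tens V W -> tens V W -> quad (tens V W)) :
  bilinear f -> multilinear4 (fun u v u' v' => f (tprod u u') (tprod v v')).
Proof.
case=> f1 f2; have [t1 t2] := tprod_bilinear V W; split=> x y z c w w' /=.
- by rewrite t1 f1.
- by rewrite t1 f2.
- by rewrite t2 f1.
- by rewrite t2 f2.
Qed.

Lemma PhiE V W (u v : V) (u' v' : W) :
  Phi V W (circ1 (tprod u u') (tprod v v')) = tprod (circ1 u v) (circ1 u' v') /\
  Phi V W (circ2 (tprod u u') (tprod v v')) = tprod (circ2 u v) (circ2 u' v').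
Proof.
have Phi_lin : linear (fun x : quad (tens V W) =>
    tlift (fun a b => tlift (fun u u' => tlift (fun v v' =>
      tprod (circ1 u v) (circ1 u' v')) b) a) x.1 +
    tlift (fun a b => tlift (fun u u' => tlift (fun v v' =>
      tprod (circ2 u v) (circ2 u' v')) b) a) x.2).
  by move=> c x x' /=; rewrite !linearP /= scalerDr addrACA.
split; rewrite linfunE //= linear0 ?addr0 ?add0r.
  exact: (tlift_tlift _ _ _ _ (tprod_multilinear4 (circ1_bilinear V) (circ1_bilinear W))).
exact: (tlift_tlift _ _ _ _ (tprod_multilinear4 (circ2_bilinear V) (circ2_bilinear W))).
Qed.

Lemma PsiE V W (u v : V) (u' v' : W) :
  [/\ Psi V W (tprod (circ1 u v) (circ1 u' v')) = circ1 (tprod u u') (tprod v v'),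
      Psi V W (tprod (circ2 u v) (circ2 u' v')) = - circ2 (tprod u u') (tprod v v'),
      Psi V W (tprod (circ1 u v) (circ2 u' v')) = 0 &
      Psi V W (tprod (circ2 u v) (circ1 u' v')) = 0].
Proof.
pose B (x : quad V) (y : quad W) : quad (tens V W) :=
    tlift (fun u v => tlift (fun u' v' =>
      circ1 (tprod u u') (tprod v v')) y.1) x.1 -
    tlift (fun u v => tlift (fun u' v' =>
      circ2 (tprod u u') (tprod v v')) y.2) x.2.
have B_bil : bilinear B.
  split=> [y c x x'|x c y y'] /=.
    by rewrite /B /= !linearP /= scalerDr addrACA.
  rewrite /B /= !(tlift_par (B := fun y u v => tlift _ y)) /=;
    first exact: subr_lin.
    by move=> v0 w0 e z z'; rewrite linearP.
  by move=> v0 w0 e z z'; rewrite linearP.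
have PsiB X Y : Psi V W (tprod X Y) = B X Y.
  have tB_lin : linear (tlift B) by move=> c z z'; rewrite linearP.
  by rewrite [LHS](linfunE tB_lin); apply: tliftE.
have nest0 (X Y : vectType k) (U : lmodType k) (M : X -> X -> Y -> Y -> U) x :
    tlift (fun u v => tlift (M u v) (0 : tens Y Y)) (x : tens X X) = 0.
  rewrite {1}/tlift big1 // => i _; rewrite big1 // => j _.
  by rewrite linear0 scaler0.
have [N1 N2] := (@tlift_nested _ _ _ _ _ _ u v u' v' (circ_multilinear4 (@circ1_bilinear (tens V W))),
  @tlift_nested _ _ _ _ _ _ u v u' v' (circ_multilinear4 (@circ2_bilinear (tens V W)))).
rewrite !PsiB /B /=; split.
- by rewrite N1 linear0 subr0.
- by rewrite N2 linear0 sub0r.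
- by rewrite nest0 linear0 subr0.
- by rewrite nest0 linear0 sub0r oppr0.
Qed.
End QuadraticDataTheory.

Section QuadraticOperads.
Variable k : fieldType.
Implicit Type V : vectType k.

Definition quad_free V (r : quad V) : freeOperad V 2 :=
  let F := freeOperad V in
  tlift (fun u v => ns_comp F (erefl 2 : 2%N = (1 + 1)%N) ord0 (freeGen u) (freeGen v)) r.1 +
  tlift (fun u v => ns_comp F (erefl 2 : 2%N = (1 + 1)%N) ord_max (freeGen u) (freeGen v)) r.2.

Fact quad_free_lin V : linear (@quad_free V).
Proof. by move=> c r r'; rewrite /quad_free /= !linearP scalerDr addrACA. Qed.
HB.instance Definition _ V :=
  GRing.isLinear.Build k (quad V) (freeOperad V 2) *:%R _ (@quad_free_lin V).

Inductive quadRel V (R : {vspace quad V}) : forall n, freeOperad V n -> Prop :=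
| QuadRel r of r \in R : quadRel R (quad_free r).

(* F(V)/(R) *)
Definition quadNsOperad V (R : {vspace quad V}) : nsOperad k :=
  quotOperad (genIdealP (quadRel R)).

Definition quadNsGen V (R : {vspace quad V}) (v : V) : quadNsOperad R 1 :=
  quotPi (genIdealP (quadRel R)) (freeGen v).
End QuadraticOperads.

(* The quotient of the free operad by all components of arity at least 4, built
   directly; it serves to prove that quad_free is bijective. *)
Section FreeArity3.
Variables (k : fieldType) (V : vectType k).

Definition truncSp n : lmodType k :=
  match n with 0 => k^o | 1 => V | 2 => quad V | _ => 'rV[k]_0 end.

Definition truncComp0 m n : 'I_m.+1 -> truncSp m -> truncSp n -> truncSp (m + n) :=
  match m, n return 'I_m.+1 -> truncSp m -> truncSp n -> truncSp (m + n) with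
  | 0, n => fun _ (a : k) b => a *: b
  | 1, 0 => fun _ a (b : k) => b *: a
  | 2, 0 => fun _ a (b : k) => b *: a
  | 1, 1 => fun i a b => if i == ord0 then circ1 a b else circ2 a b
  | _, _ => fun _ _ _ => 0
  end.

Definition truncComp m n p (e : p = (m + n)%N) (i : 'I_m.+1)
    (a : truncSp m) (b : truncSp n) : truncSp p :=
  eq_rect_r truncSp (truncComp0 i a b) e.

Lemma trunc_eq p (x y : truncSp p.+3) : x = y.
Proof. by rewrite [x]thinmx0 [y]thinmx0. Qed.

Lemma truncCompE m n (e : (m + n = m + n)%N) i a b :
  @truncComp m n _ e i a b = truncComp0 i a b.
Proof. by rewrite /truncComp (eq_axiomK e). Qed.

Program Definition truncOperad : nsOperad k :=
  @NsOperad k truncSp (1 : k) truncComp _ _ _ _ _ _.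
Next Obligation.
move=> m n p e i c a a' b; subst p; rewrite !truncCompE.
case: m i a a' => [|[|[|m]]] i a a' /=; first by rewrite scalerDl scalerA.
- case: n b => [|[|n]] b //=; rewrite ?scalerDr ?scalerA 1?mulrC //; last exact: trunc_eq.
  by case: ifP => _; [rewrite (circ1_bilinear V).1 | rewrite (circ2_bilinear V).1].
- case: n b => [|n] b //=; last exact: trunc_eq.
  by rewrite scalerDr !scalerA mulrC.
- exact: trunc_eq.
Qed.
Next Obligation.
move=> m n p e i c a b b'; subst p; rewrite !truncCompE.
case: m i a => [|[|[|m]]] i a /=; first by rewrite scalerDr !scalerA mulrC.
- case: n b b' => [|[|n]] b b' //=; rewrite ?scalerDl ?scalerA //; last exact: trunc_eq.
  by case: ifP => _; [rewrite (circ1_bilinear V).2 | rewrite (circ2_bilinear V).2].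
- case: n b b' => [|n] b b' //=; last exact: trunc_eq.
  by rewrite scalerDl scalerA.
- exact: trunc_eq.
Qed.
Next Obligation. by move=> n e a; rewrite truncCompE /= scale1r. Qed.
Next Obligation.
move=> n e i; case: n e i => [|[|[|n]]] e i a; last exact: trunc_eq.
all: by rewrite truncCompE /= ?scale1r // /GRing.scale /= mulr1.
Qed.
Next Obligation.
move=> m n q mn nq p e1 e2 e3 e4 i j h a b c.
case: (ltnP 2 p) => [|p2]; first by case: p e2 e4 => [|[|[|p]]] // *; apply: trunc_eq.
have [Z1l Z1r] := (bilinearZl (circ1_bilinear V), bilinearZr (circ1_bilinear V)).
have [Z2l Z2r] := (bilinearZl (circ2_bilinear V), bilinearZr (circ2_bilinear V)).
move: i j h a b c.
destruct m as [|[|[|m]]], n as [|[|[|n]]], q as [|[|[|q]]]; try (exfalso; lia); subst mn nq p;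
  rewrite (eq_irrelevance e4 erefl) => i j h a b c hE;
  have i1 := ltn_ord i; have j1 := ltn_ord j;
  rewrite /truncComp /eq_rect_r /= ?scalerA -?val_eqE /= ?hE ?Z1l ?Z1r ?Z2l ?Z2r //.
all: try by congr (_ *: _); apply: mulrC.
- have -> : (i + j = j)%N by lia.
  by case: ifP.
- have -> : (i + j = i)%N by lia.
  by [].
by case: ifP.
Qed.
Next Obligation.
move=> m n q mn mq p e1 e2 e3 e4 i j h i' a b c.
case: (ltnP 2 p) => [|p2]; first by case: p e2 e4 => [|[|[|p]]] // *; apply: trunc_eq.
have [Z1l Z1r] := (bilinearZl (circ1_bilinear V), bilinearZr (circ1_bilinear V)).
have [Z2l Z2r] := (bilinearZl (circ2_bilinear V), bilinearZr (circ2_bilinear V)).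
move: i j h i' a b c.
destruct m as [|[|[|m]]], n as [|[|[|n]]], q as [|[|[|q]]]; try (exfalso; lia); subst mn mq p;
  rewrite (eq_irrelevance e4 erefl) => i j h i' a b c ij hE iE;
  have i1 := ltn_ord i; have j1 := ltn_ord j; (try (exfalso; lia));
  rewrite /truncComp /eq_rect_r /= ?scalerA -?val_eqE /= ?hE ?iE ?Z1l ?Z1r ?Z2l ?Z2r //.
all: try by congr (_ *: _); apply: mulrC.
all: by rewrite ?addn0; case: ifP.
Qed.

Definition truncExt : nsMorphism (freeOperad V) truncOperad :=
  freeExt (Q := truncOperad) (idfun : {linear V -> V}).

Lemma freeGen_bilinear i :
  bilinear (fun u v => ns_comp (freeOperad V) (erefl 2 : 2%N = (1 + 1)%N) i
    (freeGen u) (freeGen v)).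
Proof.
by split=> [v c u u'|u c v v']; rewrite linearP ?ns_compDl ?ns_compDr.
Qed.

Lemma truncExt_circ i u v :
  truncExt 2%N (ns_comp (freeOperad V) (erefl 2 : 2%N = (1 + 1)%N) i
    (freeGen u) (freeGen v)) = if i == ord0 then circ1 u v else circ2 u v.
Proof. by rewrite (nsm_comp truncExt) !freeExt_gen. Qed.

Lemma truncExt_quad r : truncExt 2%N (quad_free r) = r.
Proof.
rewrite /quad_free /= linearD.
have L1 : linear (fun x : tens V V => (x, 0) : quad V).
  by move=> c x x'; apply/pair_equal_spec; rewrite /= scaler0 addr0.
have L2 : linear (fun x : tens V V => (0, x) : quad V).
  by move=> c x x'; apply/pair_equal_spec; rewrite /= scaler0 addr0.
pose f1 := HB.pack_for {linear tens V V -> quad V} (fun x : tens V V => (x, 0) : quad V)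
  (GRing.isLinear.Build k (tens V V) (quad V) *:%R _ L1).
pose f2 := HB.pack_for {linear tens V V -> quad V} (fun x : tens V V => (0, x) : quad V)
  (GRing.isLinear.Build k (tens V V) (quad V) *:%R _ L2).
pose B i u v := ns_comp (freeOperad V) (erefl 2 : 2%N = (1 + 1)%N) i
    (freeGen u) (freeGen v).
pose h i : {linear tens V V -> quad V} := truncExt 2%N \o tlift (B i).
have E1 : h ord0 =1 f1.
  apply: tlift_unique => u v /=.
  by rewrite tliftE; [apply: truncExt_circ | apply: freeGen_bilinear].
have E2 : h ord_max =1 f2.
  apply: tlift_unique => u v /=.
  by rewrite tliftE; [apply: truncExt_circ | apply: freeGen_bilinear].
rewrite [X in X + _](E1 r.1) [X in _ + X](E2 r.2).
by case: r => x y; apply/pair_equal_spec; rewrite /= addr0 add0r.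
Qed.

Lemma quad_free_surj n (x : term V n) :
  match n return freeOperad V n -> Prop with
  | 0 => fun a => exists c : k, a = c *: ns_id (freeOperad V)
  | 1 => fun a => exists v, a = freeGen v
  | 2 => fun a => exists r, a = quad_free r
  | _ => fun _ => True
  end (tcl x).
Proof.
elim: x => {n}.
- by exists 1; rewrite scale1r.
- by move=> v; exists v.
- move=> m n p e i x IHx y IHy; rewrite -freeCompE.
  rewrite -[freeComp _ _ _ _]/(ns_comp (freeOperad V) e i (tcl x) (tcl y)).
  have H0 c q (e' : q = (0 + q)%N) i' (b : freeOperad V q) :
      ns_comp (freeOperad V) e' i' (c *: ns_id _) b = c *: b.
    by rewrite (ord1 i') -[_ *: ns_id _]addr0 ns_compDl ns_comp1l ns_comp0l addr0.
  have H1 c q (e' : q = (q + 0)%N) i' (a : freeOperad V q) :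
      ns_comp (freeOperad V) e' i' a (c *: ns_id _) = c *: a.
    by rewrite -[_ *: ns_id _]addr0 ns_compDr ns_comp1r ns_comp0r addr0.
  case: p e => [|[|[|p]]] // e.
  + destruct m, n; try (exfalso; lia).
    case: IHx IHy => [c ->] [d ->]; exists (c * d).
    by rewrite H0 scalerA.
  + destruct m as [|[|]], n as [|[|]]; try (exfalso; lia).
      case: IHx IHy => [c ->] [v ->]; exists (c *: v).
      by rewrite H0 linearZ.
    case: IHx IHy => [v ->] [c ->]; exists (c *: v).
    by rewrite H1 linearZ.
  + destruct m as [|[|[|]]], n as [|[|[|]]]; try (exfalso; lia).
    * case: IHx IHy => [c ->] [r ->]; exists (c *: r).
      by rewrite H0 linearZ.
    * case: IHx IHy => [u ->] [v ->].
      rewrite (eq_irrelevance e (erefl 2 : 2%N = (1 + 1)%N)).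
      have [->|->] : i = ord0 \/ i = ord_max.
        by case: i => -[|[|i]] // ?; [left|right]; apply/val_inj.
        exists (circ1 u v); rewrite /quad_free /= linear0 addr0 tliftE //.
        exact: freeGen_bilinear.
      exists (circ2 u v); rewrite /quad_free /= linear0 add0r tliftE //.
      exact: freeGen_bilinear.
    * case: IHx IHy => [r ->] [c ->]; exists (c *: r).
      by rewrite H1 linearZ.
- move=> [|[|[|n]]] //; exists 0; rewrite ?scale0r ?linear0 //.
- move=> [|[|[|n]]] // x [a xE] y [b yE]; rewrite tcl_add xE yE.
  + by exists (a + b); rewrite scalerDl.
  + by exists (a + b); rewrite linearD.
  + by exists (a + b); rewrite linearD.
- move=> [|[|[|n]]] // c x [a xE]; rewrite tcl_scale xE.
  + by exists (c * a); rewrite scalerA.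
  + by exists (c *: a); rewrite linearZ.
  + by exists (c *: a); rewrite linearZ.
Qed.

Lemma quad_free_bij : bijective (@quad_free k V).
Proof.
exists (truncExt 2%N); first exact: truncExt_quad.
move=> a; have [x ->] := tcl_surj a; have [r ->] := quad_free_surj x.
by rewrite truncExt_quad.
Qed.
End FreeArity3.

Section BinaryQuadraticRegularOperads.
Variable k : fieldType.

(* A binary quadratic regular operad with finite dimensional generating space,
   given by its (canonical) presentation. *)
Record bqOperad := BQOperad {
  bq_gens : vectType k;
  bq_rels : {vspace quad bq_gens}
}.

Definition bq_operad (P : bqOperad) : operad k := Sigma (quadNsOperad (bq_rels P)).

Definition bq_gen (P : bqOperad) (v : bq_gens P) : bq_operad P 1 :=
  regTens (quadNsGen (bq_rels P) v) 1%g.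

Definition koszul_dual (P : bqOperad) : bqOperad :=
  BQOperad (orth (bq_rels P)).

Definition white_square (P Q : bqOperad) : bqOperad :=
  @BQOperad (tens (bq_gens P) (bq_gens Q))
    (Phi (bq_gens P) (bq_gens Q) @^-1:
       (tensv (bq_rels P) fullv + tensv fullv (bq_rels Q)))%VS.

Definition black_square (P Q : bqOperad) : bqOperad :=
  @BQOperad (tens (bq_gens P) (bq_gens Q))
    (Psi (bq_gens P) (bq_gens Q) @: tensv (bq_rels P) (bq_rels Q))%VS.
End BinaryQuadraticRegularOperads.
Arguments bq_gen {k} P v.
Coercion bq_operad : bqOperad >-> operad.

(* Main.v *)
Require Import Defs.
From HB Require Import structures.
From mathcomp Require Import all_boot all_order all_fingroup all_algebra.
From mathcomp Require Import generic_quotient boolp.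
Set Implicit Arguments.
Unset Strict Implicit.
Unset Printing Implicit Defensive.
Import GRing.Theory.
Local Open Scope ring_scope.

(** Write V, W for the generators and R, S for the relations of P and Q, and
    V', W' for the duals of V and W.  Both sides are presented operads, one
    generated by the dual of V (x) W, the other by V' (x) W'.  In finite dimension
    these spaces are canonically isomorphic ([tens_dual], [dual_tens_split]), so
    by functoriality of presented operads ([quad_iso_operad]) it is enough that
    this isomorphism matches the relations of one side with those of the other
    ([dual_black_white]).

    That is a statement about one element y of F(V' (x) W')(3).  Its image is
    orthogonal to Psi(R (x) S) when it is orthogonal to Psi(r (x) s) for all r in
    R and s in S.  As Psi is the transpose of Phi ([Psi_adjoint]), this says that
    Phi(y) pairs to zero with every r (x) s, in other words that contracting the
    first factor of Phi(y) with an r in R always gives an element of the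
    orthogonal of S.

    It remains to see that such tensors form R^perp (x) Y + X (x) S^perp, where
    X = F(V')(3) and Y = F(W')(3); this is [mem_tensv_add].  Tensors are
    linear maps from the dual of the first factor to the second, and contraction
    is evaluation.  Projecting the values onto S^perp splits the map into a part
    with values in S^perp, which lies in X (x) S^perp, and a part that vanishes
    on all functionals coming from R, which lies in R^perp (x) Y since R^perp is
    by definition the common kernel of these functionals. *)

#[local] Obligation Tactic := idtac.

(** * Morphisms out of quotients of non-symmetric operads *)

Section NsMorphismTheory.
Variable k : fieldType.
Implicit Types P Q T : nsOperad k.

Program Definition nsm_compose P Q T (g : nsMorphism Q T) (f : nsMorphism P Q) :
  nsMorphism P T := @NsMorphism _ _ _ (fun n => g n \o f n) _ _.
Next Obligation. by move=> P Q T g f /=; rewrite !nsm_id. Qed.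
Next Obligation. by move=> P Q T g f m n p e i a b /=; rewrite !nsm_comp. Qed.

Lemma kernel_isIdeal P Q (f : nsMorphism P Q) : isIdeal (fun n a => f n a = 0).
Proof.
split=> [n|n c a b fa fb|m n p e i a b fa|m n p e i a b fb].
- exact: linear0.
- by rewrite linearP fa fb scaler0 addr0.
- by rewrite nsm_comp fa ns_comp0l.
- by rewrite nsm_comp fb ns_comp0r.
Qed.

Section Quotient.
Variables (P : nsOperad k) (I : forall n, P n -> Prop) (idI : isIdeal I).

HB.instance Definition _ n := GRing.isLinear.Build k (P n) (quotOperad idI n) *:%R
  (@quotPi k P I idI n) (@quotPi_lin k P I idI n).

Program Definition quot_proj : nsMorphism P (quotOperad idI) :=
  @NsMorphism _ _ _ (fun n => @quotPi k P I idI n) _ _.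
Next Obligation. by []. Qed.
Next Obligation. by move=> m n p e i a b; rewrite [RHS]quotCompE. Qed.

Variables (Q : nsOperad k) (f : nsMorphism P Q) (f0 : forall n a, I a -> f n a = 0).

Definition quot_lift_fun n (x : quotOperad idI n) : Q n := f n (qrep x).

Lemma quot_lift_fun_pi n (a : P n) : quot_lift_fun (quotPi idI a) = f n a.
Proof.
apply/eqP; rewrite -subr_eq0 -linearB; apply/eqP/f0.
exact: (@qrepP _ (quotPre idI n)).
Qed.

Fact quot_lift_lin n : linear (@quot_lift_fun n).
Proof.
move=> c x y; have [a ->] := quotPi_surj x; have [b ->] := quotPi_surj y.
by rewrite -quotPi_lin !quot_lift_fun_pi linearP.
Qed.
HB.instance Definition _ n :=
  GRing.isLinear.Build k (quotOperad idI n) (Q n) *:%R (@quot_lift_fun n) (@quot_lift_lin n).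

Program Definition quot_lift : nsMorphism (quotOperad idI) Q :=
  @NsMorphism _ _ _ (fun n => @quot_lift_fun n) _ _.
Next Obligation. by rewrite [LHS]quot_lift_fun_pi nsm_id. Qed.
Next Obligation.
move=> m n p e i x y /=; have [a ->] := quotPi_surj x; have [b ->] := quotPi_surj y.
by rewrite quotCompE !quot_lift_fun_pi nsm_comp.
Qed.

Lemma quot_lift_pi n (a : P n) : quot_lift n (quotPi idI a) = f n a.
Proof. exact: quot_lift_fun_pi. Qed.
End Quotient.
End NsMorphismTheory.

(** * Functoriality of Sigma *)

Section SigmaFunctor.
Variables (k : fieldType) (P Q : nsOperad k) (f : nsMorphism P Q).

Definition regMap n (x : Sigma P n) : Sigma Q n := [ffun s => f n ((x : regSp P n) s)].

Fact regMap_lin n : linear (@regMap n).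
Proof. by move=> c x y; apply/ffunP=> s; rewrite !ffunE linearP. Qed.
HB.instance Definition _ n :=
  GRing.isLinear.Build k (Sigma P n) (Sigma Q n) *:%R (@regMap n) (@regMap_lin n).

Lemma regMap_tens n (a : P n) s : regMap (regTens a s) = regTens (f n a) s.
Proof. by apply/ffunP=> t; rewrite !ffunE; case: ifP; rewrite ?linear0. Qed.

Lemma regMap_comp m n p (e : p = (m + n)%N) i (x : Sigma P m) (y : Sigma P n) :
  regMap (ns_comp (Sigma P) e i x y) = ns_comp (Sigma Q) e i (regMap x) (regMap y).
Proof.
rewrite [x]regTens_sum [y]regTens_sum !ns_comp_suml !linear_sum !ns_comp_suml.
apply: eq_bigr => s _; rewrite !ns_comp_sumr linear_sum; apply: eq_bigr => t _.
by rewrite /= !regMap_tens !regCompE regMap_tens nsm_comp.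
Qed.

Lemma regMap_act n (x : Sigma P n) u :
  regMap (op_act (Sigma P) x u) = op_act (Sigma Q) (regMap x) u.
Proof.
rewrite [LHS](linear_sum (@regMap n)); apply: eq_bigr => s _.
by rewrite /= regMap_tens ffunE.
Qed.
End SigmaFunctor.

Section SigmaIso.
Variables (k : fieldType) (P Q : nsOperad k) (f : nsMorphism P Q) (g : nsMorphism Q P).
Hypotheses (fK : forall n, cancel (f n) (g n)) (gK : forall n, cancel (g n) (f n)).

Program Definition sigma_iso : operad_iso (Sigma P) (Sigma Q) :=
  @OperadIso _ _ _ (fun n => @regMap k P Q f n) _ _ (@regMap_comp k P Q f) (@regMap_act k P Q f).
Next Obligation.
move=> n; exists (@regMap k Q P g n) => x; apply/ffunP => s; rewrite !ffunE.
  exact: fK.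
exact: gK.
Qed.
Next Obligation. by rewrite /= [LHS]regMap_tens nsm_id. Qed.
End SigmaIso.

(** * Linear maps on tensors and on the arity 3 component *)

(** The pairings are known to be linear only as bare functions, which the
    structure-driven [linear0] and [linearZ] do not reach. *)
Lemma linear_at0 (k : fieldType) (U X : lmodType k) (f : U -> X) : linear f -> f 0 = 0.
Proof. by move=> /(_ (-1) 0 0); rewrite !scaleN1r oppr0 addr0 addNr. Qed.

Lemma linear_atZ (k : fieldType) (U X : lmodType k) (f : U -> X) c x :
  linear f -> f (c *: x) = c *: f x.
Proof. by move=> f_lin; have := f_lin c x 0; rewrite (linear_at0 f_lin) !addr0. Qed.

Section LinearExtensionality.
Variable k : fieldType.
Implicit Types V W : vectType k.

Lemma eq_linear_tens V W (U : lmodType k) (f g : tens V W -> U) :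
  linear f -> linear g -> (forall v w, f (tprod v w) = g (tprod v w)) -> f =1 g.
Proof.
move=> f_lin g_lin.
pose F := HB.pack_for {linear tens V W -> U} f (GRing.isLinear.Build k _ U *:%R f f_lin).
pose G := HB.pack_for {linear tens V W -> U} g (GRing.isLinear.Build k _ U *:%R g g_lin).
exact: (@tlift_unique k V W U F G).
Qed.

Lemma quad_inl_lin V : linear (fun x : tens V V => (x, 0) : quad V).
Proof. by move=> c x x'; apply/pair_equal_spec; rewrite /= scaler0 addr0. Qed.
Lemma quad_inr_lin V : linear (fun x : tens V V => (0, x) : quad V).
Proof. by move=> c x x'; apply/pair_equal_spec; rewrite /= scaler0 addr0. Qed.

Lemma eq_linear_quad V (U : lmodType k) (f g : quad V -> U) :
  linear f -> linear g ->
  (forall u v, f (circ1 u v) = g (circ1 u v)) ->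
  (forall u v, f (circ2 u v) = g (circ2 u v)) -> f =1 g.
Proof.
move=> f_lin g_lin fg1 fg2 [x y].
have -> : (x, y) = 1 *: ((x, 0) : quad V) + (0, y).
  by apply/pair_equal_spec; rewrite /= scaler0 addr0 scale1r add0r.
rewrite f_lin g_lin; congr (_ *: _ + _).
  apply: (eq_linear_tens (f := fun x => f (x, 0)) (g := fun x => g (x, 0))) => // c a b;
  by rewrite quad_inl_lin (f_lin, g_lin).
apply: (eq_linear_tens (f := fun x => f (0, x)) (g := fun x => g (0, x))) => // c a b;
by rewrite quad_inr_lin (f_lin, g_lin).
Qed.

Lemma eq_linear_quad_tens V W (U : lmodType k) (f g : quad (tens V W) -> U) :
  linear f -> linear g ->
  (forall v w v' w',
    f (circ1 (tprod v w) (tprod v' w')) = g (circ1 (tprod v w) (tprod v' w'))) ->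
  (forall v w v' w',
    f (circ2 (tprod v w) (tprod v' w')) = g (circ2 (tprod v w) (tprod v' w'))) ->
  f =1 g.
Proof.
move=> f_lin g_lin fg1 fg2.
have [[c1l c1r] [c2l c2r]] := (circ1_bilinear (tens V W), circ2_bilinear (tens V W)).
apply: eq_linear_quad => // u v.
  move: u; apply: eq_linear_tens => [c x y|c x y|u u']; rewrite ?c1l ?(f_lin, g_lin) //.
  by move: v; apply: eq_linear_tens => [c x y|c x y|v v']; rewrite ?c1r ?(f_lin, g_lin).
move: u; apply: eq_linear_tens => [c x y|c x y|u u']; rewrite ?c2l ?(f_lin, g_lin) //.
by move: v; apply: eq_linear_tens => [c x y|c x y|v v']; rewrite ?c2r ?(f_lin, g_lin).
Qed.
End LinearExtensionality.

Section QuadMap.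
Variables (k : fieldType) (A B : vectType k) (g : {linear A -> B}).

(** The arity 3 component of the morphism of free operads induced by [g]. *)
Definition quad_map (r : quad A) : quad B :=
  tlift (fun u v => circ1 (g u) (g v)) r.1 + tlift (fun u v => circ2 (g u) (g v)) r.2.

Fact quad_map_lin : linear quad_map.
Proof. by move=> c r r'; rewrite /quad_map /= !linearP scalerDr addrACA. Qed.
HB.instance Definition _ :=
  GRing.isLinear.Build k (quad A) (quad B) *:%R quad_map quad_map_lin.

Lemma bilinear_comp (U : lmodType k) (M : B -> B -> U) :
  Defs.bilinear M -> Defs.bilinear (fun u v => M (g u) (g v)).
Proof. by case=> Ml Mr; split=> [v c u u'|u c v v']; rewrite linearP (Ml, Mr). Qed.

Lemma quad_map1 u v : quad_map (circ1 u v) = circ1 (g u) (g v).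
Proof.
by rewrite /quad_map linear0 addr0 tliftE //; apply/bilinear_comp/circ1_bilinear.
Qed.
Lemma quad_map2 u v : quad_map (circ2 u v) = circ2 (g u) (g v).
Proof.
by rewrite /quad_map linear0 add0r tliftE //; apply/bilinear_comp/circ2_bilinear.
Qed.
End QuadMap.

Lemma quad_map_cancel (k : fieldType) (A B : vectType k)
    (g : {linear A -> B}) (h : {linear B -> A}) :
  cancel g h -> cancel (quad_map g) (quad_map h).
Proof.
move=> gK; apply: eq_linear_quad => [c x y|//|u v|u v]; first by rewrite !linearP.
  by rewrite !quad_map1 !gK.
by rewrite !quad_map2 !gK.
Qed.

(** * Isomorphisms of presented operads *)

Section QuadNsFunctor.
Variable k : fieldType.

Lemma quad_free1 (V : vectType k) (u v : V) : quad_free (circ1 u v) =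
  ns_comp (freeOperad V) (erefl 2 : 2%N = (1 + 1)%N) ord0 (freeGen u) (freeGen v).
Proof. by rewrite /quad_free /= linear0 addr0 tliftE //; apply: freeGen_bilinear. Qed.
Lemma quad_free2 (V : vectType k) (u v : V) : quad_free (circ2 u v) =
  ns_comp (freeOperad V) (erefl 2 : 2%N = (1 + 1)%N) ord_max (freeGen u) (freeGen v).
Proof. by rewrite /quad_free /= linear0 add0r tliftE //; apply: freeGen_bilinear. Qed.

Section Map.
Variables (A B : vectType k) (RA : {vspace quad A}) (RB : {vspace quad B}).
Variables (g : {linear A -> B}) (gR : forall r, r \in RA -> quad_map g r \in RB).

Let projB : nsMorphism (freeOperad B) (quadNsOperad RB) := quot_proj (genIdealP (quadRel RB)).

Definition quadNs_pre : nsMorphism (freeOperad A) (quadNsOperad RB) :=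
  freeExt (projB 1%N \o (freeGen (V:=B) \o g)).

Lemma quadNs_pre_quad r : quadNs_pre 2%N (quad_free r) = projB 2%N (quad_free (quad_map g r)).
Proof.
move: r; apply: eq_linear_quad => [c x y|c x y|u v|u v]; rewrite ?linearP //.
  by rewrite quad_map1 !quad_free1 !nsm_comp !freeExt_gen.
by rewrite quad_map2 !quad_free2 !nsm_comp !freeExt_gen.
Qed.

Lemma quadNs_pre0 n (a : freeOperad A n) : genIdeal (quadRel RA) a -> quadNs_pre n a = 0.
Proof.
move=> /(_ _ (kernel_isIdeal quadNs_pre)) genI; apply: genI => {a}n a [r rR].
rewrite quadNs_pre_quad -(linear0 (projB 2%N)); apply/quotPiP.
by rewrite subr0; apply: sub_genIdeal; exact: QuadRel (gR rR).
Qed.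

Definition quadNs_map : nsMorphism (quadNsOperad RA) (quadNsOperad RB) :=
  quot_lift (genIdealP (quadRel RA)) quadNs_pre0.

Lemma quadNs_map_gen v : quadNs_map 1%N (quadNsGen RA v) = quadNsGen RB (g v).
Proof. by rewrite [LHS]quot_lift_pi [LHS]freeExt_gen. Qed.
End Map.

(** Composed with the projection from the free operad, such an endomorphism
    agrees on generators with the projection itself, hence everywhere by the
    universal property. *)
Lemma quadNs_endo_id (A : vectType k) (R : {vspace quad A})
    (f : nsMorphism (quadNsOperad R) (quadNsOperad R)) :
  (forall v, f 1%N (quadNsGen R v) = quadNsGen R v) -> forall n, f n =1 id.
Proof.
move=> f1 n x; have [a ->] := quotPi_surj x.
pose pr : nsMorphism _ (quadNsOperad R) := quot_proj (genIdealP (quadRel R)).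
pose g : {linear A -> quadNsOperad R 1} := pr 1%N \o freeGen (V:=A).
have E1 := @freeExt_unique k A _ g (nsm_compose f pr) f1 n a.
have E2 := @freeExt_unique k A _ g pr (fun=> erefl) n a.
by rewrite [RHS]E2 -[RHS]E1.
Qed.

Lemma quad_iso_operad (A B : vectType k) (RA : {vspace quad A}) (RB : {vspace quad B})
    (g : {linear A -> B}) (h : {linear B -> A}) :
  cancel g h -> cancel h g -> (forall r, (quad_map g r \in RB) = (r \in RA)) ->
  exists f : operad_iso (Sigma (quadNsOperad RA)) (Sigma (quadNsOperad RB)),
    forall v, f 1%N (regTens (quadNsGen RA v) 1%g) = regTens (quadNsGen RB (g v)) 1%g.
Proof.
move=> gK hK gR.
have gR1 r : r \in RA -> quad_map g r \in RB by rewrite gR.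
have hR1 r : r \in RB -> quad_map h r \in RA by rewrite -gR (quad_map_cancel hK).
pose F := quadNs_map gR1; pose G := quadNs_map hR1.
have FK n : cancel (F n) (G n).
  apply: (@quadNs_endo_id _ _ (nsm_compose G F)) => v.
  by rewrite -[LHS]/(G 1%N (F 1%N _)) !quadNs_map_gen gK.
have GK n : cancel (G n) (F n).
  apply: (@quadNs_endo_id _ _ (nsm_compose F G)) => v.
  by rewrite -[LHS]/(F 1%N (G 1%N _)) !quadNs_map_gen hK.
exists (sigma_iso FK GK) => v.
by rewrite [LHS]regMap_tens quadNs_map_gen.
Qed.
End QuadNsFunctor.

(** * Sums of tensor products of subspaces *)

Section TensvSum.
Variables (k : fieldType) (V W : vectType k).

Lemma dual_expand (z : dual V) :
  z = \sum_(i < \dim {:V}) (z (vbasis {:V})`_i : k) *: dbasis i.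
Proof.
apply/lfunP => v; rewrite [in LHS](coord_vbasis (memvf v)) linear_sum sum_lfunE /=.
by apply: eq_bigr => i _; rewrite scale_lfunE dbasisE linearZ; apply: mulrC.
Qed.

Lemma tensv_ind (K : {vspace V}) (L : {vspace W}) (C : tens V W -> Prop) :
  C 0 -> (forall c x y, C x -> C y -> C (c *: x + y)) ->
  (forall v w, v \in K -> w \in L -> C (tprod v w)) ->
  forall x, x \in tensv K L -> C x.
Proof.
move=> C0 Clin Ct x.
rewrite -[tensv K L]/(span (in_tuple [seq tprod u w | u <- vbasis K, w <- vbasis L])).
move=> /coord_span ->; apply: big_rec => // i y _; apply: Clin.
set t := _`_i; have /allpairsP[[u w] /= [uK wL ->]] :
    t \in [seq tprod u w | u <- vbasis K, w <- vbasis L] by apply: mem_nth.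
by apply: Ct; apply: vbasis_mem.
Qed.

(** A tensor x is a linear map from the dual of V to W, whose values are its
    contractions in the first factor.  For the hard direction, subtract from x
    its composite y with a projection onto L: the values of y lie in L, those of
    the difference t vanish on A.  Expanding y along a basis of V and t along a
    basis of W exhibits them in the two summands. *)
Lemma mem_tensv_add (K : {vspace V}) (L : {vspace W}) (x : tens V W) (A : dual V -> Prop) :
  (forall v, v \in K <-> forall z, A z -> z v = 0) ->
  (x \in (tensv K fullv + tensv fullv L)%VS) <-> (forall z, A z -> x z \in L).
Proof.
move=> KA; split=> [/memv_addP[a aK [b bL ->]] z Az|xL].
  rewrite add_lfunE; have -> : a z = 0.
    elim/tensv_ind: aK => [|c a1 a2 a1z a2z|v w /KA/(_ z Az) zv _].
    - by rewrite zero_lfunE.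
    - by rewrite add_lfunE scale_lfunE a1z a2z scaler0 addr0.
    - by rewrite tprodE zv scale0r.
  rewrite add0r; elim/tensv_ind: bL => [|c b1 b2 b1L b2L|v w _ wL].
  - by rewrite zero_lfunE mem0v.
  - by rewrite add_lfunE scale_lfunE memvD ?memvZ.
  - by rewrite tprodE memvZ.
pose y : tens V W := (projv L \o x)%VF; pose t := x - y.
have -> : x = t + y by rewrite subrK.
apply: memv_add; last first.
  (* Here y = \sum_i v_i (x) y(z_i), with z_i the basis dual to v_i. *)
  rewrite [y]tens_decomp; apply: memv_suml => i _.
  under eq_bigr do rewrite -(bilinearZr (@tprod_bilinear k V W)).
  rewrite -(bilinear_sumr (@tprod_bilinear k V W)) -coord_vbasis ?memvf //.
  by rewrite mem_tensv ?memvf // comp_lfunE memv_proj.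
(* Here t = \sum_j t_j (x) w_j, where z(t_j) is the j-th coordinate of t(z). *)
rewrite [t]tens_decomp exchange_big /=; apply: memv_suml => j _.
under eq_bigr do rewrite -(bilinearZl (@tprod_bilinear k V W)).
rewrite -(bilinear_suml (@tprod_bilinear k V W)) mem_tensv ?memvf //.
apply/KA => z Az.
have tz : t z = 0 by rewrite add_lfunE opp_lfunE comp_lfunE projv_id ?subrr ?xL.
rewrite -[RHS](linear0 (coord (vbasis {:W}) j)) -tz [in RHS](dual_expand z) !linear_sum.
by apply: eq_bigr => i _; rewrite !linearZ; apply: mulrC.
Qed.
End TensvSum.

(** * The dual of a tensor product *)

Section DualTens.
Variables (k : fieldType) (V W : vectType k).

Definition tens_dual : tens (dual V) (dual W) -> dual (tens V W) := tlift (@dual_tens k V W).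
HB.instance Definition _ := GRing.Linear.on tens_dual.

Lemma tens_dualE z y : tens_dual (tprod z y) = dual_tens z y.
Proof. exact/tliftE/dual_tens_bilinear. Qed.

Definition dual_tens_split (phi : dual (tens V W)) : tens (dual V) (dual W) :=
  \sum_(i < \dim {:V}) \sum_(j < \dim {:W})
    (phi (tprod (vbasis {:V})`_i (vbasis {:W})`_j) : k) *: tprod (dbasis i) (dbasis j).
Fact dual_tens_split_lin : linear dual_tens_split.
Proof.
move=> c x y; rewrite /dual_tens_split scaler_sumr -big_split; apply: eq_bigr => i _ /=.
rewrite scaler_sumr -big_split; apply: eq_bigr => j _ /=.
by rewrite add_lfunE scale_lfunE scalerDl scalerA.
Qed.
HB.instance Definition _ := GRing.isLinear.Build k _ _ *:%R dual_tens_split dual_tens_split_lin.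

Lemma tens_dualK : cancel tens_dual dual_tens_split.
Proof.
apply: eq_linear_tens => [c x y|//|z y]; first by rewrite !linearP.
rewrite tens_dualE [z in RHS]dual_expand [y in RHS]dual_expand.
rewrite (bilinear_suml (@tprod_bilinear k _ _)); apply: eq_bigr => i _.
rewrite (bilinear_sumr (@tprod_bilinear k _ _)); apply: eq_bigr => j _.
rewrite (bilinearZl (@tprod_bilinear k _ _)) (bilinearZr (@tprod_bilinear k _ _)).
by rewrite dual_tensE scalerA.
Qed.

Lemma dual_tens_splitK : cancel dual_tens_split tens_dual.
Proof.
move=> phi; apply/lfunP; apply: eq_linear_tens => [c x y|c x y|v w]; rewrite ?linearP //.
rewrite /dual_tens_split linear_sum sum_lfunE.
rewrite [v in RHS](coord_vbasis (memvf v)) [w in RHS](coord_vbasis (memvf w)).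
rewrite (bilinear_suml (@tprod_bilinear k _ _)) linear_sum; apply: eq_bigr => i _.
rewrite (bilinear_sumr (@tprod_bilinear k _ _)) !linear_sum sum_lfunE; apply: eq_bigr => j _.
rewrite (bilinearZl (@tprod_bilinear k _ _)) (bilinearZr (@tprod_bilinear k _ _)).
rewrite !linearZ scale_lfunE /= tens_dualE dual_tensE !dbasisE.
by rewrite scalerA; apply: mulrC.
Qed.
End DualTens.

(** * Orthogonality of black and white relations *)

Lemma qform_lin (k : fieldType) (V : vectType k) : linear (@qform k V).
Proof.
by move=> c r r'; apply/lfunP => y; rewrite add_lfunE scale_lfunE !qformE qpair_linl.
Qed.

Lemma qpair_circ (k : fieldType) (V : vectType k) (u v : V) (z t : dual V) :
  [/\ qpair (circ1 u v) (circ1 z t) = (z u : k) * t v,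
      qpair (circ2 u v) (circ2 z t) = - ((z u : k) * t v),
      qpair (circ1 u v) (circ2 z t) = 0 & qpair (circ2 u v) (circ1 z t) = 0].
Proof.
have p0l y : tpair (0 : tens V V) y = 0 := linear_at0 (tpair_linl y).
have p0r x : tpair (x : tens V V) 0 = 0 := linear_at0 (tpair_linr x).
by rewrite /qpair /= !tpairE !p0l !p0r !subr0 !sub0r ?oppr0.
Qed.

Section Duality.
Variables (k : fieldType) (V W : vectType k).

(** Psi is the transpose of Phi.  The right-hand side is the pairing of
    r (x) s with Phi(y), computed by contracting with r and then with s.  Both
    sides are linear in r, s and y, so it suffices to compare them on
    compositions of generators, where the sign in Psi and the one in the pairing
    cancel as the two signs of the pairings on the right do. *)
Lemma Psi_adjoint r s y :
  qpair (Psi V W (tprod r s)) (quad_map (@tens_dual k V W) y) =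
  qpair s (Phi (dual V) (dual W) y (qform r)).
Proof.
have [tl tr] := tprod_bilinear (quad V) (quad W).
pose L r s y : k^o := qpair (Psi V W (tprod r s)) (quad_map (@tens_dual k V W) y).
pose M r s y : k^o := qpair s (Phi (dual V) (dual W) y (qform r)).
have Llin1 s' y' : linear (fun r => L r s' y').
  by move=> c a b; rewrite /L tl linearP qpair_linl.
have Llin2 r' y' : linear (fun s => L r' s y').
  by move=> c a b; rewrite /L tr linearP qpair_linl.
have Llin3 r' s' : linear (L r' s') by move=> c a b; rewrite /L linearP qpair_linr.
have Mlin1 s' y' : linear (fun r => M r s' y').
  by move=> c a b; rewrite /M qform_lin linearP qpair_linr.
have Mlin2 r' y' : linear (fun s => M r' s y') by move=> c a b; rewrite /M qpair_linl.
have Mlin3 r' s' : linear (M r' s').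
  by move=> c a b; rewrite /M linearP add_lfunE scale_lfunE qpair_linr.
have qZr (a : quad W) c b : qpair a (c *: b) = c * qpair a b.
  exact: (linear_atZ c b (qpair_linr a)).
have q0l (b : quad (dual (tens V W))) : qpair 0 b = 0 := linear_at0 (qpair_linl b).
have qNl (a : quad (tens V W)) b : qpair (- a) b = - qpair a b.
  by have := linear_atZ (-1) a (qpair_linl b); rewrite !scaleN1r.
rewrite -[LHS]/(L r s y) -[RHS]/(M r s y).
move: r; apply: (eq_linear_quad (f := fun r => L r s y) (g := fun r => M r s y)) => // u v.
all: set r := (X in L X).
all: move: s; apply: (eq_linear_quad (f := fun s => L r s y) (g := fun s => M r s y)) => // u' v'.
all: set s := (X in L _ X).
all: move: y; apply: (eq_linear_quad_tens (f := L r s) (g := M r s)) => // z z' t t'.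
all: rewrite /r /s /L /M ?(PhiE _ _ _ _).1 ?(PhiE _ _ _ _).2 tprodE qformE qZr.
all: have [P1 P2 P3 P4] := PsiE u v u' v'.
all: rewrite ?(P1, P2, P3, P4) ?quad_map1 ?quad_map2 /= !tens_dualE ?qNl ?q0l.
all: have [E1 E2 E3 E4] := qpair_circ (tprod u u') (tprod v v') (dual_tens z z') (dual_tens t t').
all: have [F1 F2 F3 F4] := qpair_circ u v z t.
all: have [G1 G2 G3 G4] := qpair_circ u' v' z' t'.
all: rewrite ?(E1, E2, E3, E4) ?(F1, F2, F3, F4) ?(G1, G2, G3, G4) ?mulr0 ?mul0r ?oppr0 //.
all: by rewrite !dual_tensE ?opprK ?mulrNN mulrACA.
Qed.

Variables (R : {vspace quad V}) (S : {vspace quad W}).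

Lemma orth_PsiP y :
  y \in orth (Psi V W @: tensv R S)%VS <->
  forall r s, r \in R -> s \in S -> qpair (Psi V W (tprod r s)) y = 0.
Proof.
split=> [/orthP y0 r s rR sS|y0]; first by apply/y0/memv_img/mem_tensv.
apply/orthP => x /memv_imgP[t tRS ->].
elim/tensv_ind: tRS => [|c a b a0 b0|r s rR sS]; last exact: y0.
- by rewrite linear0; apply: (linear_at0 (qpair_linl y)).
- by rewrite linearP qpair_linl a0 b0 scaler0 addr0.
Qed.

Lemma dual_black_white y :
  (quad_map (@tens_dual k V W) y \in orth (Psi V W @: tensv R S)%VS) =
  (y \in (Phi (dual V) (dual W) @^-1: (tensv (orth R) fullv + tensv fullv (orth S)))%VS).
Proof.
rewrite -memv_preim.
have orthR v : v \in orth R <-> forall z, (exists2 r, r \in R & z = qform r) -> z v = 0.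
  split=> [/orthP v0 _ [r rR ->]|v0]; first by rewrite qformE v0.
  by apply/orthP => r rR; rewrite -qformE; apply: v0; exists r.
apply/idP/idP => [/orth_PsiP y0|/(mem_tensv_add _ _ orthR) y0].
  apply/(mem_tensv_add _ _ orthR) => _ [r rR ->]; apply/orthP => s sS.
  by rewrite -Psi_adjoint; apply: y0.
apply/orth_PsiP => r s rR sS; rewrite Psi_adjoint.
by have /orthP := y0 _ (ex_intro2 _ _ r rR erefl); apply.
Qed.
End Duality.

Theorem proposition34 (k : fieldType) (k_char0 : [pchar k] =i pred0) (P Q : bqOperad k) :
  exists f : operad_iso (koszul_dual (black_square P Q))
                        (white_square (koszul_dual P) (koszul_dual Q)),
    forall (z : dual (bq_gens P)) (y : dual (bq_gens Q)),
      f 1%N (bq_gen (koszul_dual (black_square P Q)) (dual_tens z y)) =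
      bq_gen (white_square (koszul_dual P) (koszul_dual Q)) (tprod z y).
Proof.
have relE r : (quad_map (@dual_tens_split k (bq_gens P) (bq_gens Q)) r
      \in bq_rels (white_square (koszul_dual P) (koszul_dual Q))) =
    (r \in bq_rels (koszul_dual (black_square P Q))).
  rewrite -[LHS]dual_black_white (quad_map_cancel _) //; exact: dual_tens_splitK.
have [f fE] := quad_iso_operad (@dual_tens_splitK k _ _) (@tens_dualK k _ _) relE.
exists f => z y; rewrite -tens_dualE.
by rewrite [LHS]fE /= tens_dualK.
Qed.
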